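(* Let $p$ be an odd prime, $\omega_1,\ldots,\omega_N,x\in\mathbb C_p^\times$, $\bar\omega=(\omega_1,\ldots,\omega_N)$, and suppose $|x|_p>\|\bar\omega\|_p$. Then $$\mathrm{Log}\,\Gamma_{D,E,N}(x;\bar\omega)=x(\log_p x-1)+E_{N,1}(0;\bar\omega)\log_p x+\sum_{j=2}^\infty\frac{(-1)^{j}}{j(j-1)}E_{N,j}(0;\bar\omega)x^{-j+1}.$$
   Context: $|\cdot|_p$ is normalized by $|p|_p=p^{-1}$, $v_p$ the valuation, $\|\bar\omega\|_p=\max_i|\omega_i|_p$. For $x=p^ru\in\mathbb C_p^\times$ ($p^r$ a positive rational power of $p$ via a fixed embedding $\overline{\mathbb Q}\hookrightarrow\mathbb C_p$, $|u|_p=1$), $\hat x$ is the root of unity of order prime to $p$ with $|u-\hat x|_p<1$, and $\langle x\rangle=p^{-v_p(x)}x/\hat x$. $\log_p$ is the Iwasawa logarithm, $\log_p x=-\sum_{n\ge1}(1-x)^n/n$ for $|x-1|_p<1$, extended by $\log_p x=\log_p\langle x\rangle$. Fermionic integral $\int_{\mathbb Z_p}f\,d\mu_{-1}=\lim_{m\to\infty}\sum_{a=0}^{p^m-1}f(a)(-1)^a$, iterated over $t_1,\ldots,t_N$ for $\int_{\mathbb Z_p^N}$. With $\Lambda$ the $\mathbb Z_p$-span of the $\omega_i$ and $x\notin\Lambda$: $\zeta_{p,E,N}(s,x;\bar\omega)=\int_{\mathbb Z_p^N}\langle x+\bar\omega\cdot\bar t\rangle^{1-s}d\mu_{-1}(\bar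 t)$ and the multiple $p$-adic Diamond-Euler Log Gamma function is $\mathrm{Log}\,\Gamma_{D,E,N}(x;\bar\omega)=\frac{x}{\langle x\rangle}\frac{\partial}{\partial s}\Big(\frac{1}{s-1}\zeta_{p,E,N}(s,x;\bar\omega)\Big)\Big|_{s=0}$. Euler polynomials: $\frac{2^Ne^{xt}}{\prod_{j=1}^N(e^{\omega_jt}+1)}=\sum_{n\ge0}E_{N,n}(x;\bar\omega)\frac{t^n}{n!}$. *)

(* Defs.v *)
From HB Require Import structures.
From mathcomp Require Export all_boot all_order all_algebra all_field.
From mathcomp Require Export all_classical all_reals all_analysis.

Set Implicit Arguments.
Unset Strict Implicit.
Unset Printing Implicit Defensive.

Import Order.TTheory GRing.Theory Num.Theory.

Local Open Scope classical_set_scope.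
Local Open Scope ring_scope.

(* A field with a multiplicative ultrametric absolute value. The library's norm
   is not usable here: it satisfies `|x *+ n| = `|x| *+ n. *)
Record valuedField (R : realType) := ValuedField {
  vf_field : fieldType;
  vf_abs : vf_field -> R;
  vf_abs_ge0 : forall x, 0 <= vf_abs x;
  vf_abs_eq0 : forall x, vf_abs x = 0 <-> x = 0;
  vf_absM : forall x y, vf_abs (x * y) = vf_abs x * vf_abs y;
  vf_abs_ultra : forall x y,
    vf_abs (x + y) <= Num.max (vf_abs x) (vf_abs y)
}.

Definition vf_car (R : realType) (K : valuedField R) : Type := vf_field K.
Coercion vf_car : valuedField >-> Sortclass.

Section ValuedFieldTopology.
Variables (R : realType) (K : valuedField R).

HB.instance Definition _ := GRing.Field.on (vf_car K).

Definition pabs (x : K) : R := vf_abs x.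

Let dist (x y : K) : R := pabs (x - y).

Lemma pabsN (x : K) : pabs (- x) = pabs x.
Proof.
have h1 : pabs (1 : K) = 1.
  have h : pabs (1 : K) != 0.
    by apply/eqP => /(vf_abs_eq0 (1 : vf_field K)).1 /eqP; rewrite oner_eq0.
  by apply: (mulfI h); rewrite mulr1 -[LHS](vf_absM (1 : vf_field K)) mulr1.
have hN1 : pabs (-1 : K) = 1.
  apply/eqP; rewrite -(@pexpr_eq1 _ _ 2) ?vf_abs_ge0//.
  rewrite expr2 -[X in X == _](vf_absM (-1 : vf_field K)) mulrNN mulr1.
  by rewrite -/(pabs _) h1.
by rewrite -mulN1r [LHS](vf_absM (-1 : vf_field K)) -/(pabs _) hN1 mul1r.
Qed.

Let distxx x : dist x x = 0.
Proof. by rewrite /dist subrr; exact/(vf_abs_eq0 (0 : vf_field K)). Qed.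

Let dist_positivity x y : dist x y = 0 -> x = y.
Proof.
by move/(vf_abs_eq0 (x - y : vf_field K))/eqP; rewrite subr_eq0 => /eqP.
Qed.

Let dist_sym x y : dist x y = dist y x.
Proof. by rewrite /dist -pabsN opprB. Qed.

Let dist_triangle y x z : dist x z <= dist x y + dist y z.
Proof.
rewrite /dist -[x - z](subrKA y); apply: (le_trans (vf_abs_ultra _ _)).
by rewrite ge_max lerDl lerDr !vf_abs_ge0.
Qed.

HB.instance Definition _ := isMetric.Build R (vf_car K)
  distxx dist_positivity dist_sym dist_triangle.
HB.instance Definition _ := isPointed.Build (vf_car K) 0.

End ValuedFieldTopology.

(* Q_p and Z_p as the topological closures of Q and of N *)
Definition Qp (R : realType) (C : valuedField R) : set C :=
  closure (range (fun q : rat => ratr q : C)).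

Definition Zp (R : realType) (C : valuedField R) : set C :=
  closure (range (fun n : nat => n%:R : C)).

Definition algebraic_over (K : fieldType) (F : set K) (x : K) : Prop :=
  exists q : {poly K}, [/\ q != 0, forall i, F q`_i & root q x].

(* C is the completion of an algebraic closure of Q_p. For p prime the first
   clause forces the absolute value to be the p-adic one on Q, and the four
   clauses determine C up to isometric isomorphism. *)
Definition is_Cp (R : realType) (p : nat) (C : valuedField R) : Prop :=
  [/\ pabs (p%:R : C) = p%:R^-1,
      GRing.closed_field_axiom C,
      forall F : set_system C, ProperFilter F -> cauchy F -> cvg F &
      dense [set x : C | algebraic_over (@Qp R C) x]].

Section Defs.
Variables (R : realType) (p : nat) (C : valuedField R).
(* the fixed embedding of the algebraic numbers *)
Variable iota : {rmorphism algC -> C}.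
Implicit Types (x y s u : C).

Definition vp x : rat :=
  xget 0 [set r : rat | pabs x = (p%:R : R) `^ (- ratr r)].

(* the positive real number p^r as an algebraic number: the root of a positive
   number is the positive one *)
Definition ppow_alg (r : rat) : algC :=
  (`|denq r|%N.-root (p%:R : algC)) ^ numq r.

Definition ppow (r : rat) : C := iota (ppow_alg r).

Definition teich x : C :=
  xget 1 [set z : C | (exists n : nat, coprime n p /\ n.-primitive_root z) /\
                      pabs (x / ppow (vp x) - z) < 1].

Definition angle x : C := ppow (- vp x) * x / teich x.

(* log_p on |y - 1| < 1 *)
Definition plog1 y : C := - \big[+%R/0]_(1 <= n <oo) ((1 - y) ^+ n / n%:R).

(* angle y = y for |y - 1| < 1, so this extends plog1 *)
Definition plog x : C := plog1 (angle x).

Definition pbinom s n : C := (\prod_(i < n) (s - i%:R)) / n`!%:R.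

(* y^s for |y - 1| < 1 and s in Z_p *)
Definition ppower y s : C := \big[+%R/0]_(0 <= n <oo) (pbinom s n * (y - 1) ^+ n).

Definition fermionic (f : C -> C) : C :=
  lim ((fun m => \sum_(a < p ^ m) f a%:R * (-1) ^+ a) @ \oo).

Fixpoint fermionic_iter (N : nat) : (N.-tuple C -> C) -> C :=
  match N with
  | 0 => fun f => f [tuple]
  | N'.+1 => fun f =>
      fermionic (fun t => fermionic_iter (fun ts => f [tuple of t :: ts]))
  end.

(* meant for s in Z_p *)
Definition zetaE (N : nat) s x (w : N.-tuple C) : C :=
  fermionic_iter (fun t : N.-tuple C =>
    ppower (angle (x + \sum_(i < N) tnth w i * tnth t i)) (1 - s)).

(* derivative at a of a function defined on Z_p *)
Definition deriv_Zp (F : C -> C) (a : C) : C :=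
  lim ((F s - F a) / (s - a) @[s --> within (@Zp R C) a^']).

Definition LogGammaDE (N : nat) x (w : N.-tuple C) : C :=
  x / angle x * deriv_Zp (fun s => (s - 1)^-1 * zetaE s x w) 0.

End Defs.

(* A formal power series is the sequence of its coefficients. *)
Section PowerSeries.
Variable K : fieldType.
Implicit Types f g : nat -> K.

Definition ps1 : nat -> K := fun n => (n == 0%N)%:R.
Definition psadd f g : nat -> K := fun n => f n + g n.
Definition psscale (c : K) f : nat -> K := fun n => c * f n.
Definition psmul f g : nat -> K := fun n => \sum_(i < n.+1) f i * g (n - i)%N.
Definition psexp (a : K) : nat -> K := fun n => a ^+ n / n`!%:R.

(* the first n coefficients of 1 / f *)
Fixpoint psinv_seq f n : seq K :=
  if n is m.+1 then
    let g := psinv_seq f m in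
    rcons g (((m == 0%N)%:R - \sum_(i < m) g`_i * f (m - i)%N) / f 0%N)
  else [::].

Definition psinv f : nat -> K := fun n => (psinv_seq f n.+1)`_n.

Lemma size_psinv_seq f n : size (psinv_seq f n) = n.
Proof. by elim: n => //= n IHn; rewrite size_rcons IHn. Qed.

Lemma nth_psinv_seq f n i : (i < n)%N -> (psinv_seq f n)`_i = psinv f i.
Proof.
elim: n => // n IHn; rewrite ltnS leq_eqVlt => /predU1P[->//|lt_in].
by rewrite /= nth_rcons size_psinv_seq lt_in IHn.
Qed.

Lemma psmulVf f : f 0%N != 0 -> psmul (psinv f) f = ps1.
Proof.
move=> f0; apply/funext => n; rewrite /psmul big_ord_recr /= subnn.
rewrite {2}/psinv /= nth_rcons size_psinv_seq ltnn eqxx divfK //.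
rewrite addrC (eq_bigr (fun i : 'I_n => psinv f i * f (n - i)%N)); last first.
  by move=> i _; rewrite nth_psinv_seq.
by rewrite subrK.
Qed.

(* E_{N,n}(x; w) = n! [t^n] 2^N e^{xt} / \prod_j (e^{w_j t} + 1) *)
Definition EulerE (N n : nat) (x : K) (w : N.-tuple K) : K :=
  n`!%:R * psmul (psscale (2 ^+ N) (psexp x))
    (psinv (\big[psmul/ps1]_(j < N) psadd (psexp (tnth w j)) ps1)) n.

End PowerSeries.

(* Main.v *)
(** Put y = <x> and v(t) = (w . t) / x. Since |w . t| < |x| for every t in Z_p^N,
   the factor p^v and the Teichmüller representative of x + w . t are those of
   x, so <x + w . t> = y (1 + v(t)), a 1-unit Y(t). Expanding Y^(1 - s) in powers of
   Y - 1 and integrating termwise, zeta is sum_n binom(1 - s, n) c_n with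
   c_n the integral of (Y - 1)^n. The difference quotient at s = 0 of
   zeta(s) / (s - 1) is then c_0 / (s - 1) +
   sum_(n >= 2) binom(- s - 1, n - 2) c_n / (n (n - 1)), so the derivative is the
   integral of Y (log Y - 1). As log is additive,
   Y (log Y - 1) / y = (1 + v) (log y - 1) + v + sum_(j >= 2) (-1)^j v^j / (j (j - 1)),
   and the integral of (w . t)^j is E_{N,j}(0; w).

   All limits are exchanged with sums by one ultrametric dominated convergence
   lemma, [tendsto_is_sum]. *)

From HB Require Import structures.
Require Import Defs.
From mathcomp Require Import ring lra zify.
Import Order.TTheory GRing.Theory Num.Theory.

Set Implicit Arguments.
Unset Strict Implicit.
Unset Printing Implicit Defensive.

Local Open Scope classical_set_scope.
Local Open Scope ring_scope.

(** * Ultrametric limits and series *)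

(** The definitions are total: [lim] and [xget] return a default when nothing suitable exists, so
    existence has to precede every formula. For limits this is the role of the relations [tendsto],
    [is_sum] and [is_fint], which assert convergence. For [vp] and [teich] it comes from the density
    of the algebraic elements: every nonzero element is close to one algebraic over Q_p, so absolute
    values are rational powers of p, and residues of units are algebraic over F_p, hence torsion.
    The domination rests on two bounds: binom(s, n) has absolute value at most 1 for s in Z_p, and
    1/n has absolute value at most n. The first gives convergence uniform in s and t; the second
    admits the denominators n (n - 1) at the cost of a factor n^2. The moments come from the shift t
    -> t + 1: for p odd the alternating sum of f(t + 1) + f(t) telescopes to f(0) + f(p^m). For f =
    t^k this becomes a recurrence equivalent to M(T) (e^T + 1) = 2, M being the exponential
    generating function of the moments. *)

Section AbsoluteValue.
Variables (R : realType) (C : valuedField R).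
Implicit Types x y z : C.

Lemma pabs_ge0 x : 0 <= pabs x. Proof. exact: vf_abs_ge0. Qed.

Lemma pabs0 : pabs (0 : C) = 0.
Proof. exact/(vf_abs_eq0 (0 : vf_field C)). Qed.

Lemma pabs_eq0 x : (pabs x == 0) = (x == 0).
Proof.
apply/eqP/eqP => [/(vf_abs_eq0 (x : vf_field C))//|->]; exact: pabs0.
Qed.

Lemma pabs_gt0 x : (0 < pabs x) = (x != 0).
Proof. by rewrite lt0r pabs_eq0 pabs_ge0 andbT. Qed.

Lemma pabsM x y : pabs (x * y) = pabs x * pabs y.
Proof. exact: (vf_absM (x : vf_field C)). Qed.

Lemma pabs1 : pabs (1 : C) = 1.
Proof.
have h : pabs (1 : C) != 0 by rewrite pabs_eq0 oner_eq0.
by apply: (mulfI h); rewrite mulr1 -pabsM mulr1.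
Qed.

Lemma pabsV x : pabs x^-1 = (pabs x)^-1.
Proof.
have [->|x0] := eqVneq x 0; first by rewrite invr0 pabs0 invr0.
have h : pabs x != 0 by rewrite pabs_eq0.
by apply: (mulfI h); rewrite -pabsM !divff ?pabs1.
Qed.

Lemma pabs_div x y : pabs (x / y) = pabs x / pabs y.
Proof. by rewrite pabsM pabsV. Qed.

Lemma pabsX x n : pabs (x ^+ n) = pabs x ^+ n.
Proof. by elim: n => [|n IH]; rewrite ?expr0 ?pabs1// !exprS pabsM IH. Qed.

Lemma pabsXz x (n : int) : pabs (x ^ n) = pabs x ^ n.
Proof. by case: n => n; rewrite /exprz ?pabsV pabsX. Qed.

Lemma pabsB x y : pabs (x - y) = pabs (y - x).
Proof. by rewrite -pabsN opprB. Qed.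

Lemma pabsMsign x n : pabs (x * (-1) ^+ n) = pabs x.
Proof. by rewrite pabsM pabsX pabsN pabs1 expr1n mulr1. Qed.

Lemma pabs_addle x y e : pabs x <= e -> pabs y <= e -> pabs (x + y) <= e.
Proof. by move=> hx hy; apply: le_trans (vf_abs_ultra _ _) _; rewrite ge_max -!/(pabs _) hx. Qed.

Lemma pabs_addlt x y e : pabs x < e -> pabs y < e -> pabs (x + y) < e.
Proof. by move=> hx hy; apply: le_lt_trans (vf_abs_ultra _ _) _; rewrite gt_max -!/(pabs _) hx. Qed.

Lemma pabs_sublt x y e : pabs x < e -> pabs y < e -> pabs (x - y) < e.
Proof. by move=> hx hy; apply: pabs_addlt; rewrite ?pabsN. Qed.

Lemma pabs_suble x y e : pabs x <= e -> pabs y <= e -> pabs (x - y) <= e.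
Proof. by move=> hx hy; apply: pabs_addle; rewrite ?pabsN. Qed.

Lemma pabs_sumle (I : Type) (r : seq I) (P : pred I) (F : I -> C) e : 0 <= e ->
  (forall i, P i -> pabs (F i) <= e) -> pabs (\sum_(i <- r | P i) F i) <= e.
Proof.
move=> e0 h; apply: (big_ind (fun z : C => pabs z <= e)) => //.
  by rewrite pabs0.
by move=> x y; exact: pabs_addle.
Qed.

Lemma pabs_sumlt (I : Type) (r : seq I) (P : pred I) (F : I -> C) e : 0 < e ->
  (forall i, P i -> pabs (F i) < e) -> pabs (\sum_(i <- r | P i) F i) < e.
Proof.
move=> e0 h; apply: (big_ind (fun z : C => pabs z < e)) => //.
  by rewrite pabs0.
by move=> x y; exact: pabs_addlt.
Qed.

Lemma pabs_addl x y : pabs y < pabs x -> pabs (x + y) = pabs x.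
Proof.
move=> h; apply/le_anti/andP; split; first exact: pabs_addle (ltW h).
rewrite leNgt; apply/negP => h'.
have : pabs ((x + y) - y) < pabs x by exact: pabs_sublt.
by rewrite addrK ltxx.
Qed.

Lemma pabs_nat_le1 n : pabs (n%:R : C) <= 1.
Proof.
by elim: n => [|n IH]; rewrite ?pabs0 ?ler01// -natr1 pabs_addle ?pabs1.
Qed.

(** The filter is arbitrary, so that one toolkit covers limits along the naturals and the limit
    within [Zp] that defines the derivative. *)
Definition tendsto T (F : set_system T) (u : T -> C) (l : C) :=
  forall e, 0 < e -> \forall t \near F, pabs (u t - l) < e.

Lemma ballE x e : ball x e = [set y | pabs (x - y) < e].
Proof. exact: ballEmdist. Qed.

Lemma tendstoP T (F : set_system T) {FF : Filter F} (u : T -> C) (l : C) :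
  tendsto F u l <-> u @ F --> l.
Proof.
rewrite cvg_ballP; split=> h e e0; move: (h e e0); rewrite ?ballE;
  by apply: filterS => t /=; rewrite pabsB.
Qed.

Lemma tendsto_lim T (F : set_system T) {FF : ProperFilter F} (u : T -> C) (l : C) :
  tendsto F u l -> lim (u @ F) = l.
Proof. by move/tendstoP; apply: cvg_lim; exact: metric_hausdorff. Qed.

Lemma tendsto_unique T (F : set_system T) {FF : ProperFilter F} (u : T -> C) l l' :
  tendsto F u l -> tendsto F u l' -> l = l'.
Proof. by move=> /tendsto_lim <- /tendsto_lim. Qed.

Section Filter.
Variables (T : Type) (F : set_system T).
Context {FF : Filter F}.
Implicit Types u v : T -> C.

Lemma tendsto_near u v l : (\forall t \near F, u t = v t) ->
  tendsto F u l -> tendsto F v l.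
Proof. by move=> h hu e /hu; apply: filterS2 h => t ->. Qed.

Lemma eq_tendsto u v l : u =1 v -> tendsto F u l -> tendsto F v l.
Proof. by move=> h; apply: tendsto_near; apply: nearW. Qed.

Lemma tendsto_cst l : tendsto F (fun=> l) l.
Proof. by move=> e e0; apply: nearW => t; rewrite subrr pabs0. Qed.

Lemma tendstoD u v l k : tendsto F u l -> tendsto F v k ->
  tendsto F (fun t => u t + v t) (l + k).
Proof.
move=> hu hv e e0; apply: filterS2 (hu e e0) (hv e e0) => t h1 h2.
by rewrite opprD addrACA pabs_addlt.
Qed.

Lemma tendstoZ c u l : tendsto F u l -> tendsto F (fun t => c * u t) (c * l).
Proof.
move=> hu e e0; have [->|c0] := eqVneq c 0.
  by apply: nearW => t; rewrite !mul0r subrr pabs0.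
have c1 : 0 < pabs c by rewrite pabs_gt0.
apply: filterS (hu _ (divr_gt0 e0 c1)) => t.
by rewrite -mulrBr pabsM ltr_pdivlMr// mulrC.
Qed.

Lemma tendstoN u l : tendsto F u l -> tendsto F (fun t => - u t) (- l).
Proof. by move=> hu e /hu; apply: filterS => t; rewrite -opprD pabsN. Qed.

Lemma tendstoB u v l k : tendsto F u l -> tendsto F v k ->
  tendsto F (fun t => u t - v t) (l - k).
Proof. by move=> hu hv; apply: tendstoD => //; exact: tendstoN. Qed.

Lemma tendsto_sum (I : Type) (r : seq I) (u : T -> I -> C) (l : I -> C) :
  (forall i, tendsto F (u^~ i) (l i)) ->
  tendsto F (fun t => \sum_(i <- r) u t i) (\sum_(i <- r) l i).
Proof.
move=> h; elim: r => [|i r IH].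
  by apply: eq_tendsto (tendsto_cst _) => t; rewrite !big_nil.
rewrite big_cons; apply: eq_tendsto (tendstoD (h i) IH) => t.
by rewrite big_cons.
Qed.

Lemma tendstoM u v l k : tendsto F u l -> tendsto F v k ->
  tendsto F (fun t => u t * v t) (l * k).
Proof.
move=> hu hv.
have h0 : tendsto F (fun t => (u t - l) * (v t - k)) 0.
  move=> e e0; have m0 : 0 < Num.min e 1 by rewrite lt_min e0 ltr01.
  apply: filterS2 (hu _ m0) (hv _ m0) => t.
  rewrite !lt_min subr0 pabsM => /andP[h1 _] /andP[_ h2].
  rewrite (le_lt_trans _ h1)// ler_piMr ?pabs_ge0// ltW//.
have -> : l * k = 0 + (l * k + k * l - l * k) by ring.
have := tendstoD h0 (tendstoB (tendstoD (tendstoZ l hv) (tendstoZ k hu)) (tendsto_cst (l * k))).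
by apply: eq_tendsto => t; ring.
Qed.

Lemma tendsto_le u l e : ProperFilter F -> (\forall t \near F, pabs (u t) <= e) ->
  tendsto F u l -> pabs l <= e.
Proof.
move=> PF he hu; apply/ler_addgt0Pr => d d0.
have [t [h1 h2]] := filter_ex (filterI he (hu d d0)).
have : pabs (u t - (u t - l)) <= e + d.
  apply: pabs_suble; first by rewrite (le_trans h1)// lerDl ltW.
  rewrite (le_trans (ltW h2))// lerDr; exact: le_trans (pabs_ge0 _) h1.
by rewrite subKr.
Qed.

End Filter.

(** Unlike an equation about the infinite [\big] notation, which is a [lim], this asserts
    convergence as well. *)
Definition is_sum m (a : nat -> C) (l : C) :=
  tendsto \oo (fun n => \sum_(m <= i < n) a i) l.

Definition vanishing (B : nat -> R) :=
  forall e, 0 < e -> exists N, forall n, (N <= n)%N -> B n < e.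

Lemma is_sumP m a l : is_sum m a l -> \big[+%R/0]_(m <= i <oo) a i = l.
Proof. exact: tendsto_lim. Qed.

Lemma is_sum_cvg m a l : is_sum m a l ->
  cvg ((fun n => \sum_(m <= i < n) a i) @ \oo).
Proof. by move/tendstoP => h; apply/cvg_ex; exists l. Qed.

Lemma is_sum_unique m a l l' : is_sum m a l -> is_sum m a l' -> l = l'.
Proof. exact: tendsto_unique. Qed.

Lemma eq_is_sum m a b l : (forall i, (m <= i)%N -> a i = b i) ->
  is_sum m a l -> is_sum m b l.
Proof.
move=> h; apply: eq_tendsto => n; apply: eq_big_nat => i /andP[mi _].
exact: h.
Qed.

Lemma is_sumD m a b l k : is_sum m a l -> is_sum m b k ->
  is_sum m (fun i => a i + b i) (l + k).
Proof.
move=> ha hb; apply: eq_tendsto (tendstoD ha hb) => n.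
by rewrite big_split.
Qed.

Lemma is_sumZ m c a l : is_sum m a l -> is_sum m (fun i => c * a i) (c * l).
Proof.
by move=> ha; apply: eq_tendsto (tendstoZ c ha) => n; rewrite mulr_sumr.
Qed.

Lemma is_sum_sum m (I : Type) (r : seq I) (a : I -> nat -> C) (l : I -> C) :
  (forall i, is_sum m (a i) (l i)) ->
  is_sum m (fun n => \sum_(i <- r) a i n) (\sum_(i <- r) l i).
Proof.
move=> h; apply: eq_tendsto (tendsto_sum (u := fun n i => \sum_(m <= j < n) a i j) r h).
by move=> n; rewrite exchange_big.
Qed.

Lemma is_sum_recl m a l : is_sum m.+1 a l -> is_sum m a (a m + l).
Proof.
move=> h; apply: tendsto_near (tendstoD (tendsto_cst (a m)) h).
by exists m.+1 => // n /= mn; rewrite [RHS]big_ltn.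
Qed.

Lemma is_sum_shift m a l : is_sum m.+1 a l <-> is_sum m (fun i => a i.+1) l.
Proof.
split=> h e /h[N _ hN].
  exists N => // n /= Nn.
  by have := hN n.+1 (leqW Nn); rewrite /= big_add1.
exists N.+1 => // -[//|n] /= Nn.
by have := hN n Nn; rewrite /= big_add1.
Qed.

Lemma is_sum_tail m a l e : 0 <= e -> (forall i, (m <= i)%N -> pabs (a i) <= e) ->
  is_sum m a l -> pabs l <= e.
Proof.
move=> e0 h; apply: tendsto_le; apply: nearW => n.
by rewrite big_nat; apply: pabs_sumle => // i /andP[/h].
Qed.

Lemma is_sum_finite m n a : (forall i, (n <= i)%N -> a i = 0) ->
  is_sum m a (\sum_(m <= i < n) a i).
Proof.
move=> h; apply: tendsto_near (tendsto_cst _).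
exists (maxn m n) => // k /=; rewrite geq_max => /andP[mk nk].
have [mn|nm] := leqP m n.
  rewrite [RHS](big_cat_nat mn nk)/= [X in _ + X]big_nat.
  by rewrite [X in _ + X]big1 ?addr0// => i /andP[/h].
rewrite [LHS]big_geq ?(ltnW nm)// big_nat big1// => i /andP[mi _].
by apply: h; rewrite (leq_trans (ltnW nm)).
Qed.

Lemma is_sum_split m n a l : (m <= n)%N -> is_sum m a l ->
  is_sum n a (l - \sum_(m <= i < n) a i).
Proof.
move=> mn h; apply: tendsto_near (tendstoB h (tendsto_cst _)).
exists n => // k /= nk.
by rewrite (big_cat_nat mn nk)/= addrAC subrr add0r.
Qed.

(* The ultrametric form of Tannery's theorem: the tails are bounded uniformly
   in the parameter as soon as the terms are. *)
Lemma tendsto_is_sum T (F : set_system T) {FF : Filter F} m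
    (f : T -> nat -> C) (g : nat -> C) (B : nat -> R) (S : T -> C) (l : C) :
  vanishing B ->
  (\forall t \near F, forall n, (m <= n)%N -> pabs (f t n) <= B n) ->
  (forall n, (m <= n)%N -> pabs (g n) <= B n) ->
  (forall n, (m <= n)%N -> tendsto F (f^~ n) (g n)) ->
  (\forall t \near F, is_sum m (f t) (S t)) -> is_sum m g l ->
  tendsto F S l.
Proof.
move=> hB hf hg hfg hS hl e e0.
have e2 : 0 < e / 2 by rewrite divr_gt0.
have [N0 hN0] := hB _ e2; pose N := maxn m N0.
have mN : (m <= N)%N by rewrite leq_maxl.
(* The tails are only bounded in the weak sense, so e / 2 is what makes the later comparisons with e
   strict. *)
have hN n : (N <= n)%N -> B n <= e / 2.
  by move=> Nn; rewrite ltW// hN0// (leq_trans _ Nn)// leq_maxr.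
(* Extension by zero below m: [tendsto_sum] asks for convergence at every index, the hypotheses only
   from m on. *)
pose g' n := if (m <= n)%N then g n else 0.
pose f' t n := if (m <= n)%N then f t n else 0.
have hfin : tendsto F (fun t => \sum_(m <= i < N) f' t i) (\sum_(m <= i < N) g' i).
  apply: tendsto_sum => i; rewrite /f' /g'; case: leqP => mi.
    exact: hfg.
  exact: tendsto_cst.
apply: filterS3 hf hS (hfin e e0) => t h1 h2 h3.
have t1 := is_sum_split mN h2; have t2 := is_sum_split mN hl.
have ee : e / 2 < e by lra.
have {}t1 : pabs (S t - \sum_(m <= i < N) f t i) < e.
  apply: le_lt_trans ee; apply: is_sum_tail t1; first exact: ltW.
  move=> i Ni; apply: le_trans (h1 _ _) (hN _ Ni); exact: leq_trans Ni.
have {}t2 : pabs (l - \sum_(m <= i < N) g i) < e.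
  apply: le_lt_trans ee; apply: is_sum_tail t2; first exact: ltW.
  move=> i Ni; apply: le_trans (hg _ _) (hN _ Ni); exact: leq_trans Ni.
have t3 : pabs (\sum_(m <= i < N) f t i - \sum_(m <= i < N) g i) < e.
  rewrite (eq_big_nat _ _ (F2 := f' t)) ?(eq_big_nat _ _ (F1 := g) (F2 := g'))//.
    by move=> i /andP[mi _]; rewrite /g' mi.
  by move=> i /andP[mi _]; rewrite /f' mi.
have := pabs_addlt (pabs_sublt t1 t2) t3.
by congr (pabs _ < _); ring.
Qed.

Hypothesis complete : forall F : set_system C, ProperFilter F -> cauchy F -> cvg F.

(** In a complete ultrametric field, terms tending to 0 suffice: a block of the series is no larger
    than its largest term. *)
Lemma is_sum_ex m a B : vanishing B ->
  (forall n, (m <= n)%N -> pabs (a n) <= B n) -> exists l, is_sum m a l.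
Proof.
move=> hB ha; pose u n := \sum_(m <= i < n) a i.
have : cauchy (u @ \oo).
  apply/cauchyP => e e0; have [N hN] := hB e e0.
  exists (u (maxn m N)); exists (maxn m N) => // n /= Nn; rewrite ballE /=.
  rewrite /u (big_cat_nat (leq_maxl m N) Nn)/= opprD addNKr pabsN big_nat.
  apply: pabs_sumlt => // i /andP[+ _]; rewrite geq_max => /andP[mi Ni].
  exact: le_lt_trans (ha _ mi) (hN _ Ni).
move=> /complete /cvg_ex[l /tendstoP hl]; by exists l.
Qed.

End AbsoluteValue.

(** * Binomials and the logarithm *)

Lemma bernoulli (R : realDomainType) (d : R) n : 0 <= d -> 1 + n%:R * d <= (1 + d) ^+ n.
Proof.
move=> d0; elim: n => [|n IH]; first by rewrite mul0r addr0 expr0.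
rewrite exprSr; have h : 0 <= 1 + d by rewrite addr_ge0.
apply: le_trans (ler_wpM2r h IH); rewrite -natr1.
have := mulr_ge0 (ler0n R n) (sqr_ge0 d); rewrite expr2; lra.
Qed.

(** The factor n^2 leaves room for the denominators n and n (n - 1). *)
Lemma vanishing_sqr_geometric (R : realType) (r : R) : 0 <= r -> r < 1 ->
  vanishing (fun n => n%:R ^+ 2 * r ^+ n).
Proof.
(* With r = 1 - 3d one has r <= (1 - d)^3, and Bernoulli's inequality gives n (1 - d)^n <= 1/d.
   Cubing yields n^3 r^n <= 1/d^3, one power of n more than the claim uses up. *)
move=> r0 r1 e e0; pose d := (1 - r) / 3.
have d0 : 0 < d by rewrite /d; lra.
have d1 : d < 1 by rewrite /d; lra.
have s0 : 0 < 1 - d by lra.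
have rs : r <= (1 - d) ^+ 3.
  have -> : r = 1 - 3 * d by rewrite /d; field.
  rewrite !exprS expr0; nra.
have key n : n%:R * (1 - d) ^+ n <= d^-1.
  rewrite -(ler_pM2l d0) divff ?gt_eqF// mulrA [d * _]mulrC.
  apply: (@le_trans _ _ ((1 + d) ^+ n * (1 - d) ^+ n)).
    rewrite ler_wpM2r ?exprn_ge0 ?(ltW s0)//.
    by apply: le_trans (bernoulli n (ltW d0)); rewrite lerDr.
  rewrite -exprMn exprn_ile1//; nra.
have hB := archi_boundP (ltW (divr_gt0 (divr_gt0 ltr01 (exprn_gt0 3 d0)) e0)).
exists (Num.bound (1 / d ^+ 3 / e)).+1 => n hn.
have n0 : 0 < n%:R :> R by rewrite ltr0n; lia.
have {}hB : 1 / d ^+ 3 / e < n%:R.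
  by apply: lt_trans hB _; rewrite ltr_nat.
rewrite ltr_pdivrMr// in hB.
have k := key n; set S := (1 - d) ^+ n in k.
have S0 : 0 <= S by rewrite exprn_ge0// ltW.
have rS : r ^+ n <= S ^+ 3.
  by rewrite -exprM mulnC exprM lerXn2r ?nnegrE ?exprn_ge0 // ltW.
have k3 : (n%:R * S) ^+ 3 <= 1 / d ^+ 3.
  by rewrite div1r -exprVn lerXn2r ?nnegrE ?mulr_ge0 ?invr_ge0// ltW.
have : n%:R * (n%:R ^+ 2 * r ^+ n) < n%:R * e.
  apply: le_lt_trans hB; apply: le_trans k3.
  rewrite exprMn mulrA -exprS ler_wpM2l ?exprn_ge0//.
by rewrite ltr_pM2l.
Qed.

Lemma vanishing_geometric (R : realType) (r : R) : 0 <= r -> r < 1 ->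
  vanishing (fun n => r ^+ n).
Proof.
move=> r0 r1 e e0; have [N hN] := vanishing_sqr_geometric r0 r1 e0.
exists N.+1 => n Nn; apply: le_lt_trans (hN n (ltnW Nn)).
by rewrite ler_peMl ?exprn_ge0// exprn_ege1// ler1n; lia.
Qed.

Section PadicAbs.
Variables (R : realType) (p : nat) (C : valuedField R).
Hypotheses (p_prime : prime p) (hp : pabs (p%:R : C) = p%:R^-1).
Implicit Types (s u y : C).

Let p0 : (0 < p)%N. Proof. exact: prime_gt0. Qed.

Lemma pabs_p_lt1 : pabs (p%:R : C) < 1.
Proof. by rewrite hp invf_lt1 ?ltr0n// ltr1n prime_gt1. Qed.

(** Were |n| < 1, a Bézout combination of p and n equal to 1 would have absolute value below 1. *)
Lemma pabs_coprime n : coprime p n -> pabs (n%:R : C) = 1.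
Proof.
move=> cpn; apply/le_anti; rewrite pabs_nat_le1 leNgt; apply/negP => hn.
have /(coprimeP _ p0)[[a b] /= hab] := cpn.
have : pabs ((a%:R * p%:R - b%:R * n%:R) : C) < 1.
  by apply: pabs_sublt; rewrite pabsM;
    [apply: le_lt_trans pabs_p_lt1|apply: le_lt_trans hn];
    rewrite ler_piMl ?pabs_ge0 ?pabs_nat_le1.
by rewrite -!natrM -natrB ?hab ?pabs1 ?ltxx//; lia.
Qed.

Lemma pabs_nat n : (0 < n)%N -> pabs (n%:R : C) = p%:R ^- logn p n.
Proof.
move=> n0; have [m cpm hn] := pfactor_coprime p_prime n0.
by rewrite {1}hn natrM natrX pabsM pabs_coprime// mul1r pabsX hp exprVn.
Qed.

Lemma natr_neq0 n : (0 < n)%N -> n%:R != 0 :> C.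
Proof.
by move=> n0; rewrite -pabs_eq0 pabs_nat// invr_eq0 expf_neq0// pnatr_eq0 -lt0n.
Qed.

(** For n > 0 the left side is the p-part of n, a divisor of n. *)
Lemma pabs_natV_le n : pabs (n%:R^-1 : C) <= n%:R.
Proof.
case: n => [|n]; first by rewrite invr0 pabs0.
rewrite pabsV pabs_nat// invrK -natrX ler_nat dvdn_leq//.
exact: pfactor_dvdnn.
Qed.

Lemma tendsto_pX : tendsto \oo (fun k => (p ^ k)%:R : C) 0.
Proof.
move=> e e0; have [N hN] := vanishing_geometric (pabs_ge0 _) pabs_p_lt1 e0.
by exists N => // n /hN; rewrite /= subr0 natrX pabsX.
Qed.

Lemma pbinomS s n : pbinom s n.+1 = pbinom s n * (s - n%:R) / n.+1%:R.
Proof.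
rewrite /pbinom big_ord_recr/= factS natrM invfM; ring.
Qed.

Lemma pbinomS1 s n : pbinom s n.+1 = s * pbinom (s - 1) n / n.+1%:R.
Proof.
rewrite /pbinom big_ord_recl/= subr0 factS natrM invfM.
under eq_bigr => i _ do rewrite /bump /= natrD opprD addrA.
ring.
Qed.

Lemma pbinom0 s : pbinom s 0 = 1.
Proof. by rewrite /pbinom big_ord0 fact0 divr1. Qed.

Lemma pbinom_nat m n : pbinom (m%:R : C) n = 'C(m, n)%:R.
Proof.
elim: n => [|n IH]; first by rewrite pbinom0 bin0.
rewrite pbinomS IH; apply: (mulIf (natr_neq0 (ltn0Sn n))).
rewrite divfK ?natr_neq0// -natrM mulnC mul_bin_left.
have [mn|nm] := ltnP m n; first by rewrite bin_small// muln0 mul0r.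
by rewrite mulrC natrM natrB.
Qed.

Lemma pbinomN1 n : pbinom (-1 : C) n = (-1) ^+ n.
Proof.
elim: n => [|n IH]; first by rewrite pbinom0 expr0.
rewrite pbinomS IH exprSr -mulrA; congr (_ * _).
by rewrite -opprD nat1r mulNr divff// natr_neq0.
Qed.

(** On the unit ball the numerator is a product of functions bounded by 1 and 1-Lipschitz, hence is
    both itself; only the denominator n! costs something. *)
Lemma pbinom_lip s t n : pabs s <= 1 -> pabs t <= 1 ->
  pabs (pbinom s n - pbinom t n) <= pabs (s - t) / pabs (n`!%:R : C).
Proof.
move=> s1 t1; rewrite /pbinom -mulrBl pabs_div ler_wpM2r ?invr_ge0 ?pabs_ge0//.
suff [] : pabs (\prod_(i < n) (s - i%:R)) <= 1 /\
  pabs (\prod_(i < n) (s - i%:R) - \prod_(i < n) (t - i%:R)) <= pabs (s - t) by [].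
elim: n => [|n [IH1 IH2]].
  by rewrite !big_ord0 subrr pabs0 pabs1 pabs_ge0.
have st i : pabs (t - i%:R) <= 1 by rewrite pabs_suble ?pabs_nat_le1.
rewrite !big_ord_recr/=; set P := \prod_(i < n) _ in IH1 IH2 *.
set Q := \prod_(i < n) _ in IH2 *; split.
  by rewrite pabsM mulr_ile1 ?pabs_ge0// pabs_suble ?pabs_nat_le1.
have -> : P * (s - n%:R) - Q * (t - n%:R) = P * (s - t) + (P - Q) * (t - n%:R) by ring.
apply: pabs_addle; rewrite pabsM.
  by rewrite ler_piMl ?pabs_ge0.
by apply: le_trans IH2; rewrite ler_piMr ?pabs_ge0.
Qed.

Lemma ZpP s : @Zp R C s <-> forall e, 0 < e -> exists m : nat, pabs (s - m%:R) < e.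
Proof.
split=> [h e e0|h B].
  have [_ [[m _ <-]]] := h _ (nbhsx_ballx s _ e0).
  by rewrite ballE => hm; exists m.
rewrite -nbhs_ballE => -[e /= e0 hB]; have [m hm] := h e e0.
exists m%:R; split; first by exists m.
by apply: hB; rewrite ballE.
Qed.

Lemma Zp_le1 s : @Zp R C s -> pabs s <= 1.
Proof.
move=> /ZpP /(_ _ ltr01)[m hm]; rewrite -[s](subrK m%:R).
by rewrite pabs_addle ?pabs_nat_le1// ltW.
Qed.

Lemma ZpD s t : @Zp R C s -> @Zp R C t -> @Zp R C (s + t).
Proof.
move=> /ZpP hs /ZpP ht; apply/ZpP => e e0.
have [m hm] := hs e e0; have [n hn] := ht e e0.
by exists (m + n)%N; rewrite natrD opprD addrACA pabs_addlt.
Qed.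

Lemma Zp_nat n : @Zp R C n%:R.
Proof. by apply/ZpP => e e0; exists n; rewrite subrr pabs0. Qed.

Lemma ZpN s : @Zp R C s -> @Zp R C (- s).
Proof.
move=> /ZpP hs; apply/ZpP => e e0; have [m hm] := hs e e0.
have [N _ /(_ N (leqnn N)) /=] := tendsto_pX e0; rewrite subr0 => hN.
(* The number -m is close to m (p^N - 1), which is natural. *)
exists (m * (p ^ N).-1)%N.
have -> : - s - (m * (p ^ N).-1)%:R = - (s - m%:R) - m%:R * (p ^ N)%:R.
  have q0 : (0 < p ^ N)%N by rewrite expn_gt0 p0.
  by rewrite -[in RHS](prednK q0) -natr1 natrM; ring.
rewrite pabs_sublt ?pabsN// pabsM (le_lt_trans _ hN)//.
by rewrite ler_piMl ?pabs_ge0// pabs_nat_le1.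
Qed.

(** At a natural m the binomial is an integer. Taking m within |n!| of s, the Lipschitz bound makes
    the change from m to s at most 1. *)
Lemma pbinom_le1 s n : @Zp R C s -> pabs (pbinom s n) <= 1.
Proof.
move=> hs; have f0 : 0 < pabs (n`!%:R : C) by rewrite pabs_gt0 natr_neq0// fact_gt0.
have /ZpP /(_ _ f0)[m hm] := hs.
rewrite -[pbinom s n](subrK (pbinom m%:R n)).
apply: pabs_addle; last by rewrite pbinom_nat pabs_nat_le1.
apply: le_trans (pbinom_lip _ (Zp_le1 hs) (pabs_nat_le1 _ _)) _.
by rewrite ler_pdivrMr// mul1r ltW.
Qed.

Lemma tendsto_pbinom T (F : set_system T) {FF : Filter F} (u : T -> C) s n :
  (\forall t \near F, pabs (u t) <= 1) -> pabs s <= 1 ->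
  tendsto F u s -> tendsto F (fun t => pbinom (u t) n) (pbinom s n).
Proof.
move=> hu hs us e e0.
have f0 : 0 < pabs (n`!%:R : C) by rewrite pabs_gt0 natr_neq0// fact_gt0.
apply: filterS2 hu (us _ (mulr_gt0 e0 f0)) => t h1 h2.
by apply: le_lt_trans (pbinom_lip _ h1 hs) _; rewrite ltr_pdivrMr.
Qed.

Lemma pabs_expr_divn_le u n : pabs (u ^+ n / n%:R) <= n%:R ^+ 2 * pabs u ^+ n.
Proof.
rewrite pabsM pabsX mulrC ler_wpM2r ?exprn_ge0 ?pabs_ge0//.
apply: le_trans (pabs_natV_le _) _; by rewrite -natrX ler_nat -mulnn; nia.
Qed.

Lemma vanishing_pow u : pabs u < 1 -> vanishing (fun n => n%:R ^+ 2 * pabs u ^+ n).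
Proof. by move=> u1; apply: vanishing_sqr_geometric => //; exact: pabs_ge0. Qed.

Hypothesis complete : forall F : set_system C, ProperFilter F -> cauchy F -> cvg F.

Lemma is_sum_plog1 u : pabs u < 1 ->
  is_sum 1 (fun n => (-1) ^+ n.-1 * (u ^+ n / n%:R)) (plog1 (1 + u)).
Proof.
move=> u1; pose a n := (1 - (1 + u)) ^+ n / n%:R.
have hB : vanishing (fun n => n%:R ^+ 2 * pabs (1 - (1 + u)) ^+ n).
  by apply: vanishing_pow; rewrite opprD addNKr pabsN.
have [l hl] := is_sum_ex complete (m := 1) (a := a) hB
   (fun n _ => pabs_expr_divn_le _ n).
rewrite /plog1 (is_sumP hl) -[X in is_sum _ _ X]mulN1r; apply: eq_is_sum (is_sumZ (-1) hl).
case=> // i _; rewrite /a opprD addNKr (exprNn u) (exprS (-1)) /=; ring.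
Qed.

(* ((1 + u)^q - 1) / q is the sum of binom (q - 1) (n - 1) u^n / n, and
   binom (q - 1) (n - 1) tends to binom (-1) (n - 1) as q = p^k tends to 0. *)
Lemma tendsto_plog1 u : pabs u < 1 ->
  tendsto \oo (fun k => ((1 + u) ^+ (p ^ k) - 1) / (p ^ k)%:R) (plog1 (1 + u)).
Proof.
move=> u1.
pose f k n := pbinom ((p ^ k).-1%:R : C) n.-1 * (u ^+ n / n%:R).
have q0 k : (0 < p ^ k)%N by rewrite expn_gt0 p0.
apply: (@tendsto_is_sum _ _ _ _ _ 1 f (fun n => (-1) ^+ n.-1 * (u ^+ n / n%:R))
  (fun n => n%:R ^+ 2 * pabs u ^+ n)).
- exact: vanishing_pow.
- apply: nearW => k n _; rewrite /f pabsM; apply: le_trans (pabs_expr_divn_le _ _).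
  by rewrite ler_piMl ?pabs_ge0// pbinom_nat pabs_nat_le1.
- move=> n _; apply: le_trans (pabs_expr_divn_le _ _).
  by rewrite mulrC pabsMsign.
- move=> n _; rewrite -pbinomN1; apply: tendstoM (tendsto_cst _).
  apply: tendsto_pbinom; first by apply: nearW => k; exact: pabs_nat_le1.
    by rewrite pabsN pabs1.
  rewrite -[X in tendsto _ _ X]sub0r.
  by apply: eq_tendsto (tendstoB tendsto_pX (tendsto_cst 1)) => k; rewrite -subn1 natrB.
- apply: nearW => k.
  (* Binomial theorem together with q binom(q - 1, i) = (i + 1) binom(q, i + 1); for n > q the terms
     [f k n] are zero. *)
  have -> : ((1 + u) ^+ (p ^ k) - 1) / (p ^ k)%:R = \sum_(1 <= i < (p ^ k).+1) f k i.
    apply: (mulIf (natr_neq0 (q0 k))); rewrite divfK ?natr_neq0// exprDn.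
    rewrite big_ord_recl/= expr1n expr0 mul1r bin0 addrC addKr.
    rewrite big_add1 /= big_mkord mulr_suml; apply: eq_bigr => i _.
    rewrite /f /bump /= add1n expr1n mul1r pbinom_nat -mulr_natl.
    have := mul_bin_diag (p ^ k) i => /(congr1 (fun n => n%:R : C)).
    rewrite !natrM; have := natr_neq0 (ltn0Sn i).
    move: (i.+1%:R : C) => c c0 h.
    by rewrite /= [RHS]mulrC !mulrA h; field.
  apply: is_sum_finite => i hi; rewrite /f pbinom_nat bin_small ?mul0r//.
  by have := q0 k; lia.
- exact: is_sum_plog1.
Qed.

(** Write U = 1 + u, V = 1 + v and q = p^k. Then (UV)^q - 1 = (U^q - 1) + U^q (V^q - 1), where U^q
    tends to 1; dividing by q and passing to the limit gives the sum. *)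
Lemma plog1M u v : pabs u < 1 -> pabs v < 1 ->
  plog1 ((1 + u) * (1 + v)) = plog1 (1 + u) + plog1 (1 + v).
Proof.
move=> u1 v1; have -> : (1 + u) * (1 + v) = 1 + (u + v + u * v) by ring.
have w1 : pabs (u + v + u * v) < 1.
  rewrite !pabs_addlt// pabsM (le_lt_trans _ v1)// ler_piMl ?pabs_ge0//; exact: ltW.
have Lu := tendsto_plog1 u1; have Lv := tendsto_plog1 v1.
apply: (tendsto_unique (tendsto_plog1 w1)).
have Lu1 : tendsto \oo (fun k => (1 + u) ^+ (p ^ k)) 1.
  suff : tendsto \oo (fun k => (1 + u) ^+ (p ^ k)) (1 + 0 * plog1 (1 + u)).
    by rewrite mul0r addr0.
  apply: eq_tendsto (tendstoD (tendsto_cst 1) (tendstoM tendsto_pX Lu)) => k.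
  by rewrite mulrC divfK ?natr_neq0// ?expn_gt0 ?p0// addrC subrK.
rewrite -[plog1 (1 + v)]mul1r.
apply: eq_tendsto (tendstoD Lu (tendstoM Lu1 Lv)) => k.
rewrite mulrA -mulrDl; congr (_ / _).
have -> : 1 + (u + v + u * v) = (1 + u) * (1 + v) by ring.
by rewrite exprMn; ring.
Qed.

(** The coefficients of u log(1 + u) and log(1 + u) combine by 1/(n - 1) - 1/n = 1/(n (n - 1)). It
    is applied both to Y - 1, for the derivative, and to v, for the final series. *)
Lemma is_sum_entropy u : pabs u < 1 ->
  is_sum 2 (fun n => (-1) ^+ n / (n%:R * (n%:R - 1)) * u ^+ n)
    ((1 + u) * plog1 (1 + u) - u).
Proof.
move=> u1; have h := is_sum_plog1 u1.
have h1 := is_sum_split (isT : (1 <= 2)%N) h.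
rewrite big_nat1 /= expr0 mul1r expr1 divr1 in h1.
have h2 : is_sum 2 (fun n => u * ((-1) ^+ n.-2 * (u ^+ n.-1 / n.-1%:R))) (u * plog1 (1 + u)).
  exact/is_sum_shift/is_sumZ.
have -> : (1 + u) * plog1 (1 + u) - u = u * plog1 (1 + u) + (plog1 (1 + u) - u) by ring.
apply: eq_is_sum (is_sumD h2 h1) => -[//|[//|n]] _ /=.
have e1 := natr_neq0 (ltn0Sn n); have e2 := natr_neq0 (ltn0Sn n.+1).
rewrite -(natr1 n.+1) addrK.
rewrite -(natr1 n.+1) in e2.
move: e1 e2; move: (n.+1%:R : C) => c c0 c1.
rewrite !exprS; field; by rewrite c0 c1.
Qed.

End PadicAbs.

(** * Fermionic moments and Euler polynomials *)

Section PowerSeriesTheory.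
Variable K : fieldType.
Implicit Types f g h : nat -> K.

Lemma coefM_eq (a b a' b' : {poly K}) n :
  (forall i, (i <= n)%N -> a`_i = a'`_i) -> (forall i, (i <= n)%N -> b`_i = b'`_i) ->
  (a * b)`_n = (a' * b')`_n.
Proof.
move=> ha hb; rewrite !coefM; apply: eq_bigr => -[i /= hi] _.
by rewrite ha ?hb ?leq_subr.
Qed.

(** The ring laws of power series are imported from polynomials by truncating, since a coefficient
    of a product only involves coefficients of lower or equal degree. *)
Lemma psmul_poly f g m n : (m <= n)%N ->
  psmul f g m = ((\poly_(i < n.+1) f i) * (\poly_(i < n.+1) g i))`_m.
Proof.
move=> mn; rewrite coefM; apply: eq_bigr => -[i /= hi] _.
by rewrite !coef_poly !ltnS (leq_trans _ mn) ?(leq_trans (leq_subr _ _) mn).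
Qed.

Lemma psmulC : commutative (@psmul K).
Proof.
by move=> f g; apply/funext => n; rewrite !(psmul_poly _ _ (leqnn n)) mulrC.
Qed.

Lemma psmulA : associative (@psmul K).
Proof.
move=> f g h; apply/funext => n; rewrite !(psmul_poly _ _ (leqnn n)).
set F := \poly_(i < n.+1) f i; set G := \poly_(i < n.+1) g i.
set H := \poly_(i < n.+1) h i.
rewrite (@coefM_eq F _ F (G * H))//; last first.
  by move=> i hi; rewrite coef_poly ltnS hi (psmul_poly _ _ hi).
rewrite mulrA; apply: coefM_eq => // i hi.
by rewrite coef_poly ltnS hi (psmul_poly _ _ hi).
Qed.

Lemma psscale1mul c f : psmul (psscale c (@ps1 K)) f = psscale c f.
Proof.
apply/funext => n; rewrite /psmul big_ord_recl /psscale /ps1 /= subn0 mulr1.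
by rewrite big1 ?addr0// => i _; rewrite mulr0 mul0r.
Qed.

Lemma psscale1 f : psscale 1 f = f.
Proof. by apply/funext => n; rewrite /psscale mul1r. Qed.

Lemma psmul1 : left_id (@ps1 K) (@psmul K).
Proof. by move=> f; rewrite -[ps1 K]psscale1 psscale1mul psscale1. Qed.

End PowerSeriesTheory.

HB.instance Definition _ (K : fieldType) :=
  Monoid.isComLaw.Build (nat -> K) (@ps1 K) (@psmul K) (@psmulA K) (@psmulC K) (@psmul1 K).

Section PowerSeriesInverse.
Variable K : fieldType.
Implicit Types f g h : nat -> K.

Lemma psinv_unique c f g : f 0%N != 0 -> psmul g f = psscale c (@ps1 K) ->
  g = psscale c (psinv f).
Proof.
move=> f0 h; rewrite -psscale1mul -h -psmulA [psmul f _]psmulC psmulVf//.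
by rewrite psmulC psmul1.
Qed.

Lemma bigpsmul0 (I : Type) (r : seq I) (F : I -> nat -> K) :
  (\big[@psmul K/@ps1 K]_(i <- r) F i) 0%N = \prod_(i <- r) F i 0%N.
Proof.
elim: r => [|i r IH]; first by rewrite !big_nil.
by rewrite !big_cons -IH /psmul big_ord1.
Qed.

Lemma psexp0 : psexp (0 : K) = @ps1 K.
Proof.
apply/funext => -[|n]; rewrite /psexp /ps1 ?expr0 ?fact0 ?divr1//.
by rewrite expr0n mul0r.
Qed.

Lemma bigpsmul_scale c N :
  \big[@psmul K/@ps1 K]_(i < N) psscale c (@ps1 K) = psscale (c ^+ N) (@ps1 K).
Proof.
elim: N => [|N IH]; first by rewrite big_ord0 expr0 psscale1.
rewrite big_ord_recl IH psscale1mul exprS; apply/funext => n.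
by rewrite /psscale mulrA.
Qed.

(** Splits the generating function into factors 2 / (e^(w_j t) + 1), each characterized by its
    product with e^(w_j t) + 1. *)
Lemma EulerE_unique N (w : N.-tuple K) (M : 'I_N -> nat -> K) n : (2 : K) != 0 ->
  (forall j, psmul (M j) (psadd (psexp (tnth w j)) (@ps1 K)) = psscale 2 (@ps1 K)) ->
  EulerE n 0 w = n`!%:R * (\big[@psmul K/@ps1 K]_(j < N) M j) n.
Proof.
move=> two h; rewrite /EulerE psexp0 psscale1mul; congr (_ * _).
rewrite -(@psinv_unique (2 ^+ N) _ (\big[@psmul K/@ps1 K]_(j < N) M j))//.
  rewrite bigpsmul0; apply/prodf_neq0 => j _.
  by rewrite /psadd /psexp /ps1 expr0 fact0 divr1.
by rewrite -big_split -bigpsmul_scale; apply: eq_bigr => j _; exact: h.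
Qed.

End PowerSeriesInverse.

(** * Iterated fermionic integrals and the moments of linear forms *)

Section FermionicIntegral.
Variables (R : realType) (p : nat) (C : valuedField R).
Hypotheses (p_prime : prime p) (p_odd : odd p).
Hypothesis hp : pabs (p%:R : C) = p%:R^-1.
Hypothesis complete : forall F : set_system C, ProperFilter F -> cauchy F -> cvg F.

(** The only points at which the finite sums evaluate the integrand; bounds and identities are
    needed only there. *)
Definition natural_tuple N (t : N.-tuple C) :=
  forall x, x \in t -> exists a : nat, x = a%:R.

Lemma natural_cons N (a : nat) (t : N.-tuple C) :
  natural_tuple t -> natural_tuple [tuple of a%:R :: t].
Proof. by move=> h x; rewrite inE => /predU1P[->|/h//]; exists a. Qed.

Lemma natural_le1 N (t : N.-tuple C) i : natural_tuple t -> pabs (tnth t i) <= 1.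
Proof. by move=> /(_ _ (mem_tnth i t))[a ->]; exact: pabs_nat_le1. Qed.

(* Unlike [fermionic_iter f = l], this asserts that all the limits exist, and it
   only involves the values of f at tuples of natural numbers. *)
Fixpoint is_fint (N : nat) : (N.-tuple C -> C) -> C -> Prop :=
  match N with
  | 0 => fun f l => l = f [tuple]
  | N'.+1 => fun f l => exists g : nat -> C,
      (forall a : nat, is_fint (fun ts => f [tuple of a%:R :: ts]) (g a)) /\
      tendsto \oo (fun m => \sum_(a < p ^ m) g a * (-1) ^+ a) l
  end.

Lemma is_fintP N (f : N.-tuple C -> C) l : is_fint f l -> fermionic_iter p f = l.
Proof.
elim: N f l => [f l ->//|N IH f l [g [hg hl]]] /=.
rewrite /fermionic -(tendsto_lim hl); congr (lim (_ @ \oo)); apply/funext => m.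
by apply: eq_bigr => a _; rewrite (IH _ _ (hg a)).
Qed.

Lemma eq_is_fint N (f g : N.-tuple C -> C) l :
  (forall t, natural_tuple t -> f t = g t) -> is_fint f l -> is_fint g l.
Proof.
elim: N f g l => [f g l h /= ->|N IH f g l h /= [h' [hh' hl]]].
  by rewrite h// => x; rewrite inE.
exists h'; split=> // a; apply: IH (hh' a) => t ht.
by apply: h; exact: natural_cons.
Qed.

Lemma is_fint_le N (f : N.-tuple C -> C) l e :
  (forall t, natural_tuple t -> pabs (f t) <= e) -> is_fint f l -> pabs l <= e.
Proof.
elim: N f l => [f l h /= ->|N IH f l h /= [g [hg hl]]].
  by rewrite h// => x; rewrite inE.
have hga a : pabs (g a) <= e.
  by apply: IH (hg a) => t ht; apply: h; exact: natural_cons.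
apply: tendsto_le hl; apply: nearW => m.
by apply: pabs_sumle => [|a _]; rewrite ?pabsMsign// (le_trans _ (hga 0%N))// pabs_ge0.
Qed.

Lemma is_fintD N (f g : N.-tuple C -> C) l k : is_fint f l -> is_fint g k ->
  is_fint (fun t => f t + g t) (l + k).
Proof.
elim: N f g l k => [f g l k /= -> ->//|N IH f g l k /= [f' [hf hl]] [g' [hg hk]]].
exists (fun a => f' a + g' a); split=> [a|]; first exact: IH.
apply: eq_tendsto (tendstoD hl hk) => m.
by rewrite -big_split; apply: eq_bigr => a _; rewrite mulrDl.
Qed.

Lemma is_fintZ N c (f : N.-tuple C -> C) l : is_fint f l ->
  is_fint (fun t => c * f t) (c * l).
Proof.
elim: N f l => [f l /= ->//|N IH f l /= [f' [hf hl]]].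
exists (fun a => c * f' a); split=> [a|]; first exact: IH.
apply: eq_tendsto (tendstoZ c hl) => m.
by rewrite mulr_sumr; apply: eq_bigr => a _; rewrite mulrA.
Qed.

Lemma is_fint0 N : is_fint (fun _ : N.-tuple C => 0) 0.
Proof.
elim: N => [//|N IH] /=; exists (fun=> 0); split=> //.
apply: eq_tendsto (tendsto_cst 0) => m.
by rewrite big1// => a _; rewrite mul0r.
Qed.

Lemma is_fint_sum N (I : Type) (r : seq I) (f : I -> N.-tuple C -> C) (l : I -> C) :
  (forall i, is_fint (f i) (l i)) ->
  is_fint (fun t => \sum_(i <- r) f i t) (\sum_(i <- r) l i).
Proof.
move=> h; elim: r => [|i r IH].
  by rewrite big_nil; apply: eq_is_fint (is_fint0 N) => t _; rewrite big_nil.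
rewrite big_cons; apply: eq_is_fint (is_fintD (h i) IH) => t _.
by rewrite big_cons.
Qed.

(** Termwise integration, one coordinate at a time by [tendsto_is_sum]. Integration does not
    increase a bound on the integrand, so the same [B] serves at every level. *)
Lemma is_fint_series N m (f : nat -> N.-tuple C -> C) (S : N.-tuple C -> C)
    (l : nat -> C) L (B : nat -> R) : vanishing B ->
  (forall n t, (m <= n)%N -> natural_tuple t -> pabs (f n t) <= B n) ->
  (forall t, natural_tuple t -> is_sum m (f^~ t) (S t)) ->
  (forall n, is_fint (f n) (l n)) -> is_sum m l L -> is_fint S L.
Proof.
move=> hB; elim: N f S l L => [f S l L hf hS hl hL /=|N IH f S l L hf hS hl hL /=].
  apply: is_sum_unique hL _; apply: eq_is_sum (hS [tuple] _) => [n _|x].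
    by rewrite hl.
  by rewrite inE.
have [g hg] := choice hl.
have hgB n a : (m <= n)%N -> pabs (g n a) <= B n.
  move=> mn; apply: is_fint_le ((hg n).1 a) => t ht.
  by apply: hf => //; exact: natural_cons.
have [G hG] := choice (fun a => is_sum_ex complete hB (fun n => @hgB n a)).
exists G; split=> [a|].
  apply: (IH (fun n ts => f n [tuple of a%:R :: ts]) _ (g^~ a)) => //.
  - by move=> n t mn ht; apply: hf => //; exact: natural_cons.
  - by move=> t ht; apply: hS; exact: natural_cons.
  - by move=> n; exact: (hg n).1.
apply: (@tendsto_is_sum _ _ _ _ _ m
  (fun k n => \sum_(a < p ^ k) g n a * (-1) ^+ a) l B) => //.
- apply: nearW => k n mn; apply: pabs_sumle => [|a _].
    exact: le_trans (pabs_ge0 _) (hgB n 0%N mn).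
  by rewrite pabsMsign hgB.
- by move=> n mn; apply: is_fint_le (hl n) => t ht; exact: hf.
- by move=> n _; exact: (hg n).2.
- apply: nearW => k; apply: is_sum_sum => a; rewrite mulrC.
  by apply: eq_is_sum (is_sumZ _ (hG a)) => n _; rewrite mulrC.
Qed.

Let two_neq0 : (2 : C) != 0. Proof. exact: (natr_neq0 p_prime hp). Qed.

Let fact_neq0 n : n`!%:R != 0 :> C.
Proof. by rewrite (natr_neq0 p_prime hp)// fact_gt0. Qed.

Lemma alt_telescope (h : nat -> C) q :
  \sum_(a < q) (h a.+1 + h a) * (-1) ^+ a = h 0%N - h q * (-1) ^+ q.
Proof.
elim: q => [|q IH]; first by rewrite big_ord0 expr0 mulr1 subrr.
by rewrite big_ord_recr IH /= exprSr; ring.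
Qed.

(** [alt_telescope] for a^k, with (a + 1)^k expanded; as p^m is odd, the boundary term at p^m enters
    with a plus sign. *)
Lemma alt_power_sum k m :
  \sum_(i < k.+1) 'C(k, i)%:R * (\sum_(a < p ^ m) a%:R ^+ i * (-1) ^+ a)
    + \sum_(a < p ^ m) a%:R ^+ k * (-1) ^+ a = 0 ^+ k + ((p ^ m)%:R : C) ^+ k.
Proof.
have := alt_telescope (fun a => a%:R ^+ k) (p ^ m).
rewrite -signr_odd oddX p_odd orbT expr1 mulrN1 opprK => <-.
under [in RHS]eq_bigr => a _ do rewrite mulrDl.
rewrite big_split; congr (_ + _).
under [LHS]eq_bigr => i _ do rewrite mulr_sumr.
rewrite exchange_big; apply: eq_bigr => a _.
rewrite -natr1 addrC exprDn mulr_suml; apply: eq_bigr => i _.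
by rewrite expr1n mul1r [RHS]mulrnAl mulr_natl.
Qed.

Definition fmoment k : C := fermionic p (fun t => t ^+ k).

(** In [alt_power_sum] the k-th power sum occurs twice, once as the term i = k, and all others have
    lower exponent. Since 2 is invertible, strong induction applies. *)
Lemma tendsto_fmoment k :
  tendsto \oo (fun m => \sum_(a < p ^ m) (a%:R : C) ^+ k * (-1) ^+ a) (fmoment k).
Proof.
suff [l hl] : exists l, tendsto \oo (fun m => \sum_(a < p ^ m) (a%:R : C) ^+ k * (-1) ^+ a) l.
  by rewrite /fmoment /fermionic (tendsto_lim hl).
elim/ltn_ind: k => k IH.
have /choice[l hl] : forall i : 'I_k, exists l, tendsto \oo
    (fun m => \sum_(a < p ^ m) (a%:R : C) ^+ i * (-1) ^+ a) l.
  by move=> i; exact: IH.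
have [q hq] : exists q, tendsto \oo (fun m => ((p ^ m)%:R : C) ^+ k) q.
  case: k {IH l hl} => [|k].
    by exists 1; apply: eq_tendsto (tendsto_cst 1) => m; rewrite expr0.
  exists (0 ^+ k.+1); elim: k => [|k IH].
    by rewrite expr1; apply: eq_tendsto (tendsto_pX p_prime hp) => m; rewrite expr1.
  rewrite exprS; apply: eq_tendsto (tendstoM (tendsto_pX p_prime hp) IH) => m.
  by rewrite [RHS]exprS.
have hs : tendsto \oo (fun m => \sum_(i < k) 'C(k, i)%:R *
    \sum_(a < p ^ m) (a%:R : C) ^+ i * (-1) ^+ a) (\sum_(i < k) 'C(k, i)%:R * l i).
  apply: (tendsto_sum (u := fun m (i : 'I_k) => 'C(k, i)%:R *
    \sum_(a < p ^ m) (a%:R : C) ^+ i * (-1) ^+ a) _) => i.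
  exact: tendstoZ.
exists (2^-1 * (0 ^+ k + q - \sum_(i < k) 'C(k, i)%:R * l i)).
apply: eq_tendsto (tendstoZ 2^-1 (tendstoB (tendstoD (tendsto_cst (0 ^+ k)) hq) hs)) => m.
rewrite -alt_power_sum big_ord_recr /= binn mul1r.
by field; exact: two_neq0.
Qed.

(** The limit of [alt_power_sum]. At k = 0 both boundary powers equal 1, whence the 2. *)
Lemma fmoment_rec k :
  \sum_(i < k.+1) 'C(k, i)%:R * fmoment i + fmoment k = 2 * (k == 0%N)%:R.
Proof.
apply: (@tendsto_unique _ _ _ (\oo : set_system nat) _
  (fun m => 0 ^+ k + ((p ^ m)%:R : C) ^+ k)).
  have hs : tendsto \oo (fun m => \sum_(i < k.+1) 'C(k, i)%:R *
      \sum_(a < p ^ m) (a%:R : C) ^+ i * (-1) ^+ a) (\sum_(i < k.+1) 'C(k, i)%:R * fmoment i).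
    apply: (tendsto_sum (u := fun m (i : 'I_k.+1) => 'C(k, i)%:R *
      \sum_(a < p ^ m) (a%:R : C) ^+ i * (-1) ^+ a) _) => i.
    exact: tendstoZ (tendsto_fmoment i).
  apply: eq_tendsto (tendstoD hs (tendsto_fmoment k)).
  by move=> m; rewrite alt_power_sum.
case: k => [|k] /=.
  by apply: eq_tendsto (tendsto_cst _) => m; rewrite !expr0 mulr1.
rewrite mulr0 exprS mul0r.
suff h : tendsto \oo (fun m => ((p ^ m)%:R : C) ^+ k.+1) 0.
  by rewrite -[X in tendsto _ _ X]addr0; exact: tendstoD (tendsto_cst 0) h.
elim: k => [|k IH].
  by apply: eq_tendsto (tendsto_pX p_prime hp) => m; rewrite expr1.
rewrite -[X in tendsto _ _ X](mulr0 0).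
by apply: eq_tendsto (tendstoM (tendsto_pX p_prime hp) IH) => m; rewrite [RHS]exprS.
Qed.

(** The formal expansion in T of the integral of e^(c t T) over t. *)
Definition moment_series (c : C) : nat -> C := fun k => c ^+ k * fmoment k / k`!%:R.

Lemma bin_facts k i : (i <= k)%N -> 
  'C(k, i)%:R = k`!%:R / (i`!%:R * (k - i)`!%:R) :> C.
Proof.
move=> ik; rewrite -(bin_fact ik) !natrM; field.
by rewrite !fact_neq0.
Qed.

Lemma moment_seriesM c :
  psmul (moment_series c) (psadd (psexp c) (@ps1 C)) = psscale 2 (@ps1 C).
Proof.
apply/funext => k; rewrite /psscale /ps1.
(* This is [fmoment_rec] times c^k / k!; the factorials turn the binomial sum into a Cauchy
   product. *)
transitivity (c ^+ k / k`!%:R * (2 * (k == 0%N)%:R)); last first.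
  by case: k => [|k] /=; rewrite ?expr0 ?fact0 ?divr1 ?mul1r// !mulr0.
rewrite -fmoment_rec mulrDr mulr_sumr.
rewrite /psmul /psadd; under eq_bigr => i _ do rewrite mulrDr.
rewrite big_split /=; congr (_ + _).
  apply: eq_bigr => -[i /=]; rewrite ltnS => ik _.
  rewrite bin_facts// /moment_series /psexp.
  rewrite -[in RHS](subnKC ik) exprD (subnKC ik).
  by field; rewrite !fact_neq0.
rewrite big_ord_recr /= subnn big1 ?add0r /moment_series; first by rewrite mulr1; ring.
by move=> -[i /= ik] _; rewrite subn_eq0 leqNgt ik mulr0.
Qed.

Lemma is_fint_pow N (w : N.-tuple C) k :
  is_fint (fun t : N.-tuple C => (\sum_(i < N) tnth w i * tnth t i) ^+ k) (EulerE k 0 w).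
Proof.
(* Done before the induction, which then peels one factor off a product of moment series. *)
rewrite (EulerE_unique _ two_neq0 (fun j => moment_seriesM (tnth w j))).
elim: N w k => [w k|N IH w k] /=.
  by rewrite !big_ord0 expr0n /ps1; case: k => [|k]; rewrite ?mulr0// fact0 mulr1.
case/tupleP: w => c w; pose Q := \big[@psmul C/@ps1 C]_(j < N) moment_series (tnth w j).
(* The integral over the remaining coordinates with the first one fixed at a, by the binomial
   theorem and the induction hypothesis. *)
exists (fun a => \sum_(i < k.+1) 'C(k, i)%:R * (c * a%:R) ^+ (k - i) * (i`!%:R * Q i)).
split=> [a|].
  apply: eq_is_fint (is_fint_sum (index_enum _) (fun i : 'I_k.+1 =>
    is_fintZ ('C(k, i)%:R * (c * a%:R) ^+ (k - i)) (IH w i))) => t _.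
  rewrite [in RHS]big_ord_recl !tnth0 exprDn; apply: eq_bigr => i _.
  rewrite -mulrA mulr_natl; congr (_ * _ ^+ _ *+ _).
  by apply: eq_bigr => j _; rewrite !tnthS.
rewrite big_ord_recl tnth0.
rewrite (eq_bigr (fun j => moment_series (tnth w j))); last first.
  by move=> j _; rewrite tnthS.
rewrite -/Q psmulC /psmul mulr_sumr.
apply: eq_tendsto (tendsto_sum (l := fun i : 'I_k.+1 => k`!%:R * (Q i * moment_series c (k - i)))
  (u := fun m (i : 'I_k.+1) => 'C(k, i)%:R * c ^+ (k - i) * (i`!%:R * Q i) *
    (\sum_(a < p ^ m) a%:R ^+ (k - i) * (-1) ^+ a)) (index_enum _) _).
  move=> m; under [RHS]eq_bigr => a _ do rewrite mulr_suml.
  rewrite [RHS]exchange_big; apply: eq_bigr => i _.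
  rewrite mulr_sumr; apply: eq_bigr => a _; rewrite exprMn; ring.
move=> [i /=]; rewrite ltnS => ik.
have -> : k`!%:R * (Q i * moment_series c (k - i)) =
    'C(k, i)%:R * c ^+ (k - i) * (i`!%:R * Q i) * fmoment (k - i).
  rewrite bin_facts// /moment_series; field; by rewrite !fact_neq0.
exact: tendstoZ (tendsto_fmoment _).
Qed.

End FermionicIntegral.

(** * Value group and residue field *)

Lemma monic_splits (F : fieldType) (closedF : GRing.closed_field_axiom F)
    (q : {poly F}) : q \is monic -> exists s : seq F, q = \prod_(z <- s) ('X - z%:P).
Proof.
have [n] := ubnP (size q); elim: n q => // n IH q hn mq.
have [q1|] := eqVneq (size q) 1%N.
  exists [::]; rewrite big_nil; move/eqP/size_poly1P: q1 mq => [c _ ->].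
  by rewrite monicE lead_coefC => /eqP->.
move=> /(PreClosedField.closed_rootP closedF)[z /factor_theorem[q' hq]].
have mq' : q' \is monic by move: mq; rewrite hq monicMr// monicXsubC.
have [|s hs] := IH q' _ mq'.
  by move: hn; rewrite hq size_Mmonic ?monicXsubC ?monic_neq0// size_XsubC addn2.
by exists (z :: s); rewrite big_cons -hs mulrC.
Qed.

Section Cp.
Variables (R : realType) (p : nat) (C : valuedField R).
Hypotheses (p_prime : prime p) (hp : pabs (p%:R : C) = p%:R^-1).
Implicit Types (a u x y z : C).

Let p0 : (0 < p)%N. Proof. exact: prime_gt0. Qed.

Lemma pabs_int (n : int) : pabs (n%:~R : C) = pabs (`|n|%N%:R : C).
Proof. by case: n => n; rewrite ?NegzE ?mulrNz ?pabsN ?abszN. Qed.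

Lemma pabs_ratE (r : rat) :
  pabs (ratr r : C) = pabs (`|numq r|%N%:R : C) / pabs (`|denq r|%N%:R : C).
Proof. by rewrite /ratr pabs_div !pabs_int. Qed.

Lemma absz_denq_gt0 (r : rat) : (0 < `|denq r|)%N.
Proof. by rewrite absz_gt0 denq_neq0. Qed.

Lemma pabs_rat (r : rat) : r != 0 -> exists k : int, pabs (ratr r : C) = p%:R ^ k.
Proof.
move=> r0; have n0 : (0 < `|numq r|)%N by rewrite absz_gt0 numq_eq0.
exists ((logn p `|denq r|)%:Z - (logn p `|numq r|)%:Z).
rewrite pabs_ratE !(pabs_nat p_prime hp) ?absz_denq_gt0// invrK mulrC.
by rewrite expfzDr ?pnatr_eq0 -?lt0n// exprnN.
Qed.

Lemma pabs_dvd n : (p %| n)%N -> pabs (n%:R : C) < 1.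
Proof.
move=> /dvdnP[m ->]; rewrite natrM pabsM.
apply: le_lt_trans (pabs_p_lt1 p_prime hp).
by rewrite ler_piMl ?pabs_ge0// pabs_nat_le1.
Qed.

Lemma int_residue (n : int) : exists m : nat, pabs ((n%:~R : C) - m%:R) < 1.
Proof.
case: n => n; first by exists n; rewrite subrr pabs0.
(* Modulo p, -(n + 1) is congruent to (p - 1)(n + 1). *)
exists (p.-1 * n.+1)%N; rewrite NegzE mulrNz -opprD pabsN.
have -> : (n.+1%:~R : C) + (p.-1 * n.+1)%:R = (p * n.+1)%:R.
  by rewrite -natrD -mulSn prednK.
by rewrite pabs_dvd// dvdn_mulr.
Qed.

(** For a reduced fraction, absolute value at most 1 keeps p out of the denominator, which then has
    an inverse [a] modulo p. *)
Lemma rat_residue (r : rat) : pabs (ratr r : C) <= 1 ->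
  exists m : nat, pabs ((ratr r : C) - m%:R) < 1.
Proof.
move=> r1; have d0 := absz_denq_gt0 r.
have cpd : coprime p `|denq r|.
  rewrite prime_coprime//; apply/negP => pd.
  have cpn : coprime p `|numq r|.
    by rewrite (coprime_dvdl pd)// coprime_sym coprime_num_den.
  move: r1; rewrite pabs_ratE (pabs_coprime p_prime hp cpn) div1r leNgt => /negP[].
  by rewrite invf_gt1 ?pabs_dvd// pabs_gt0 (natr_neq0 p_prime hp).
have dE : (denq r)%:~R = (`|denq r|%N%:R : C).
  by rewrite -{1}[denq r]gez0_abs// ltW// denq_gt0.
have /(coprimeP _ d0)[[a b] /= hab] : coprime `|denq r| p by rewrite coprime_sym.
have [n' hn'] := int_residue (numq r).
exists (n' * a)%N; set d := (`|denq r|%N%:R : C) in dE *.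
have dd : d != 0 by exact: (natr_neq0 p_prime hp).
have -> : ratr r - (n' * a)%:R = (((numq r)%:~R - n'%:R) - (n' * b * p)%:R) / d.
  have h : (a%:R * d : C) = 1 + b%:R * p%:R.
    by rewrite /d -!natrM nat1r; congr _%:R; lia.
  rewrite /ratr dE; apply: (mulIf dd); rewrite mulrBl !divfK// !natrM.
  by rewrite -[n'%:R * a%:R * d]mulrA h; ring.
rewrite pabs_div (pabs_coprime p_prime hp cpd) divr1 pabs_sublt// pabs_dvd//.
exact: dvdn_mull.
Qed.

Lemma intr_neq0 (d : int) : d != 0 -> d%:~R != 0 :> C.
Proof.
by move=> d0; rewrite -pabs_eq0 pabs_int pabs_eq0 (natr_neq0 p_prime hp)// absz_gt0.
Qed.

(** Nonzero integers stay nonzero in C, so unreduced fractions may be used as well as the reduced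
    one in [ratr]. *)
Lemma ratr_div (n d : int) : d != 0 ->
  ratr (n%:~R / d%:~R) = n%:~R / d%:~R :> C.
Proof.
move=> d0; set r : rat := n%:~R / d%:~R.
have h : numq r * d = n * denq r.
  apply/eqP; rewrite -(eqr_int rat) !intrM numqE /r mulrAC divfK ?intr_eq0//.
have e0 := intr_neq0 d0; have e1 := intr_neq0 (denq_neq0 r).
apply: (mulIf e0); apply: (mulIf e1); rewrite divfK// -intrM -h intrM /ratr.
by rewrite mulrAC divfK.
Qed.

Lemma ratr_div_residue (r s : rat) : s != 0 -> pabs (ratr r : C) <= pabs (ratr s : C) ->
  exists m : nat, pabs ((ratr r : C) / ratr s - m%:R) < 1.
Proof.
move=> s0 rs.
have d0 : denq r * numq s != 0 by rewrite mulf_neq0 ?denq_neq0 ?numq_eq0.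
have e : ratr ((numq r * denq s)%:~R / (denq r * numq s)%:~R) = ratr r / ratr s :> C.
  rewrite ratr_div// /ratr !intrM !invfM invrK; ring.
rewrite -e; apply: rat_residue; rewrite e pabs_div ler_pdivrMr ?mul1r//.
by rewrite pabs_gt0 /ratr mulf_neq0 ?invr_eq0 ?intr_neq0 ?denq_neq0 ?numq_eq0.
Qed.

Lemma Qp_approx a e : @Qp R C a -> 0 < e -> exists r : rat, pabs (a - ratr r) < e.
Proof.
move=> h e0; have [_ [[r _ <-]]] := h _ (nbhsx_ballx a _ e0).
by rewrite ballE => hr; exists r.
Qed.

Lemma pabs_Qp a : @Qp R C a -> a != 0 -> exists k : int, pabs a = p%:R ^ k.
Proof.
move=> ha a0; have a1 : 0 < pabs a by rewrite pabs_gt0.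
have [r hr] := Qp_approx ha a1.
have e : pabs (ratr r : C) = pabs a.
  by rewrite -(pabs_addl (x := a) (y := - (a - ratr r))) ?pabsN// opprB addrC subrK.
have r0 : r != 0 by apply: contraTneq a1 => r0; rewrite -e r0 /ratr mul0r pabs0 ltxx.
by have [k hk] := pabs_rat r0; exists k; rewrite -e.
Qed.

(** Newton polygon argument: a vanishing sum cannot have a unique term of maximal absolute value,
    and two terms that tie express a power of |a| through absolute values of elements of Q_p. *)
Lemma pabs_algebraic a : algebraic_over (@Qp R C) a -> a != 0 ->
  exists (k : int) (n : nat), (0 < n)%N /\ pabs a ^+ n = p%:R ^ k.
Proof.
move=> [q [q0 hq /rootP]]; rewrite horner_coef => ha a0.
have s0 : (0 < size q)%N by rewrite size_poly_gt0.
case: (arg_maxP (fun i : 'I_(size q) => pabs (q`_i * a ^+ i))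
  (isT : xpredT (Ordinal s0))) => i _ /= himax.
have M0 : 0 < pabs (q`_i * a ^+ i).
  have h : ((size q).-1 < size q)%N by rewrite prednK.
  apply: lt_le_trans (himax (Ordinal h) isT).
  by rewrite pabs_gt0 mulf_neq0 ?expf_neq0// -lead_coefE lead_coef_eq0.
have : exists j, j != i /\ pabs (q`_j * a ^+ j) = pabs (q`_i * a ^+ i).
  apply: contrapT => hno; move: ha.
  rewrite (bigD1 i)//= => /(congr1 (@pabs R C)); rewrite pabs0 pabs_addl.
    by move=> h; move: M0; rewrite h ltxx.
  apply: pabs_sumlt => // j ji; rewrite lt_neqAle himax// andbT.
  by apply/eqP => h; apply: hno; exists j.
case=> j [ji]; rewrite !pabsM !pabsX.
have q_neq0 k : pabs (q`_k * a ^+ k) = pabs (q`_i * a ^+ i) -> q`_k != 0.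
  by move=> hk; apply: contraTneq M0 => hk0; rewrite -hk hk0 mul0r pabs0 ltxx.
move=> hij; have qi := q_neq0 i erefl; have qj : q`_j != 0 by apply: q_neq0; rewrite !pabsM !pabsX.
have A0 : pabs a != 0 by rewrite pabs_eq0.
have [k hk] := pabs_Qp (hq i) qi; have [l hl] := pabs_Qp (hq j) qj.
have pR : p%:R != 0 :> R by rewrite pnatr_eq0 -lt0n.
have aux (m n : nat) (k' l' : int) : (m < n)%N ->
    p%:R ^ l' * pabs a ^+ n = p%:R ^ k' * pabs a ^+ m ->
    exists (k : int) (n : nat), (0 < n)%N /\ pabs a ^+ n = p%:R ^ k.
  move=> mn h; exists (k' - l'), (n - m)%N; split; first by rewrite subn_gt0.
  apply: (mulIf (expf_neq0 m A0)); rewrite -exprD subnK ?(ltnW mn)//.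
  apply: (mulfI (expfz_neq0 l' pR)); rewrite h mulrA -expfzDr//.
  by rewrite addrC subrK.
rewrite hk hl in hij; move: ji; rewrite -val_eqE neq_ltn /= => /orP[ji|ij].
  exact: aux ji (esym hij).
exact: aux ij hij.
Qed.

Hypothesis hdense : dense [set x : C | algebraic_over (@Qp R C) x].

Lemma algebraic_approx x e : 0 < e -> exists a, algebraic_over (@Qp R C) a /\ pabs (x - a) < e.
Proof.
move=> e0; have hx : nbhs x (ball x e)° by apply: nbhs_interior; exact: nbhsx_ballx.
have [] := hdense (O := (ball x e)°); [by exists x; exact: nbhs_singleton|exact: open_interior|].
by move=> a [/interior_subset]; rewrite ballE => ha alg; exists a.
Qed.

(** Guarantees that the [xget] in [vp] selects a genuine exponent. *)
Lemma pabs_value_group x : x != 0 -> exists r : rat, pabs x = p%:R `^ (- ratr r).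
Proof.
move=> x0; have x1 : 0 < pabs x by rewrite pabs_gt0.
have [a [alg ha]] := algebraic_approx x x1.
have e : pabs a = pabs x.
  by rewrite -(pabs_addl (x := x) (y := - (x - a))) ?pabsN// opprB addrC subrK.
have a0 : a != 0 by rewrite -pabs_gt0 e.
have [k [n [n0 hk]]] := pabs_algebraic alg a0; rewrite e in hk.
exists (- (k%:~R / n%:R)); rewrite rmorphN opprK rmorphM/= ratr_int fmorphV/= ratr_nat.
rewrite powRrM powR_intmul// -hk -powR_mulrn ?pabs_ge0// -powRrM.
by rewrite divff ?pnatr_eq0 -?lt0n// powRr1 ?pabs_ge0.
Qed.

(** Modulo elements of absolute value below 1, [a] satisfies a monic equation with natural
    coefficients: the coefficients are approximated by rationals, divided by a dominant one, and
    replaced by natural residues. *)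
Lemma algebraic_monic_residue a : algebraic_over (@Qp R C) a -> pabs a <= 1 ->
  exists d (c : 'I_d -> nat), pabs (a ^+ d - \sum_(i < d) (c i)%:R * a ^+ i) < 1.
Proof.
move=> [q [q0 hq /rootP]]; rewrite horner_coef => ha a1.
have s0 : (0 < size q)%N by rewrite size_poly_gt0.
case: (arg_maxP (fun i : 'I_(size q) => pabs q`_i)
  (isT : xpredT (Ordinal s0))) => i0 _ /= hmax0.
pose M := pabs q`_i0.
(* Taking the last coefficient of maximal size makes all later ones negligible after division, so
   the reduced equation is monic of degree d. *)
case: (arg_maxnP (P := fun i : 'I_(size q) => pabs q`_i == M) (i0 := i0)
  (fun i : 'I_(size q) => nat_of_ord i) (eqxx _)) => d /eqP hd hlast.
have hmax (i : 'I_(size q)) : pabs q`_i <= M by exact: hmax0.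
have M0 : 0 < M.
  have h : ((size q).-1 < size q)%N by rewrite prednK.
  by apply: lt_le_trans (hmax (Ordinal h)); rewrite pabs_gt0 /= -lead_coefE lead_coef_eq0.
have /choice[r hr] : forall i, exists r : rat, pabs (q`_i - ratr r) < M.
  by move=> i; exact: Qp_approx.
have rE i : ratr (r i) = q`_i - (q`_i - ratr (r i)) :> C by rewrite subKr.
have rM (i : 'I_(size q)) : pabs (ratr (r i) : C) <= M.
  by rewrite rE pabs_suble// ltW.
have rd : pabs (ratr (r d) : C) = M by rewrite rE pabs_addl ?pabsN hd.
have rgt (i : 'I_(size q)) : (d < i)%N -> pabs (ratr (r i) : C) < M.
  move=> di; rewrite rE pabs_sublt// lt_neqAle hmax andbT.
  by apply/negP => /hlast; rewrite /= leqNgt di.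
have ai i : pabs (a ^+ i) <= 1 by rewrite pabsX exprn_ile1 ?pabs_ge0.
have Mle (z : C) i : pabs z < M -> pabs (z * a ^+ i) < M.
  by move=> hz; rewrite pabsM (le_lt_trans _ hz)// ler_piMr ?pabs_ge0.
have h1 : pabs (\sum_(i < size q) ratr (r i) * a ^+ i) < M.
  have -> : \sum_(i < size q) ratr (r i) * a ^+ i =
      \sum_(i < size q) (ratr (r i) - q`_i) * a ^+ i.
    under [RHS]eq_bigr => i _ do rewrite mulrBl.
    by rewrite sumrB ha subr0.
  by apply: pabs_sumlt => // i _; rewrite Mle// pabsB.
have h2 : pabs (\sum_(i < d.+1) ratr (r i) * a ^+ i) < M.
  rewrite (big_ord_widen (size q) (fun i => ratr (r i) * a ^+ i)) ?ltn_ord//.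
  rewrite (bigID (fun i : 'I_(size q) => (i < d.+1)%N))/= in h1.
  rewrite -[X in pabs X](addrK (\sum_(i < size q | ~~ (i < d.+1)%N) ratr (r i) * a ^+ i)).
  apply: pabs_sublt => //; apply: pabs_sumlt => // i; rewrite ltnS -ltnNge => di.
  exact/Mle/rgt.
have rd0 : ratr (r d) != 0 :> C by rewrite -pabs_gt0 rd.
have rdq : r d != 0 by apply: contraNneq rd0 => ->; rewrite /ratr mul0r.
have /choice[c hc] : forall i : 'I_d, exists m : nat,
    pabs ((ratr (- r i) : C) / ratr (r d) - m%:R) < 1.
  move=> i; apply: ratr_div_residue => //; rewrite rd.
  have := rM (Ordinal (ltn_trans (ltn_ord i) (ltn_ord d))).
  by rewrite /ratr numqN denqN mulrNz mulNr pabsN.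
exists d, c.
have -> : a ^+ d - \sum_(i < d) (c i)%:R * a ^+ i =
    (\sum_(i < d.+1) ratr (r i) * a ^+ i) / ratr (r d) +
    \sum_(i < d) ((ratr (- r i) : C) / ratr (r d) - (c i)%:R) * a ^+ i.
  rewrite big_ord_recr/= mulrDl mulrAC divff// mul1r mulr_suml addrAC -big_split/= addrC.
  rewrite -sumrN; congr (_ + _); apply: eq_bigr => i _.
  by rewrite /ratr numqN denqN mulrNz; ring.
apply: pabs_addlt; first by rewrite pabs_div rd ltr_pdivrMr// mul1r.
apply: pabs_sumlt => // i _; rewrite pabsM (le_lt_trans _ (hc i))//.
by rewrite ler_piMr ?pabs_ge0.
Qed.

End Cp.

(** * Teichmüller representatives *)

Section Teichmuller.
Variables (R : realType) (p : nat) (C : valuedField R).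
Hypotheses (p_prime : prime p) (hp : pabs (p%:R : C) = p%:R^-1).
Implicit Types (a u v x z : C).

Let p0 : (0 < p)%N. Proof. exact: prime_gt0. Qed.

Lemma residue_trans a b c : pabs (a - b) < 1 -> pabs (b - c) < 1 -> pabs (a - c) < 1.
Proof. by move=> h1 h2; rewrite -(subrKA b) pabs_addlt. Qed.

Lemma pabs_subX_le a b n : pabs a <= 1 -> pabs b <= 1 ->
  pabs (a ^+ n - b ^+ n) <= pabs (a - b).
Proof.
move=> a1 b1; rewrite subrXX pabsM ler_piMr ?pabs_ge0//.
apply: pabs_sumle => // i _.
by rewrite pabsM !pabsX mulr_ile1 ?exprn_ge0 ?pabs_ge0// exprn_ile1 ?pabs_ge0.
Qed.

Lemma pow_residue_span a d (c : 'I_d -> nat) : pabs a <= 1 ->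
  pabs (a ^+ d - \sum_(i < d) (c i)%:R * a ^+ i) < 1 ->
  forall k, exists b : 'I_d -> nat, pabs (a ^+ k - \sum_(i < d) (b i)%:R * a ^+ i) < 1.
Proof.
case: d c => [|d] c a1 hc k.
  (* For d = 0 the hypothesis would read |1| < 1. *)
  by exists c; move: hc; rewrite !big_ord0 !subr0 expr0 pabs1 ltxx.
elim: k => [|k [b hb]].
  exists (fun i => (i == ord0)%N).
  rewrite big_ord_recl /= big1 ?addr0 ?mul1r ?subrr ?pabs0//.
  by move=> i _; rewrite mul0r.
(* Multiplication by [a] shifts the coefficients [b]; the overflowing top power is replaced through
   the relation [c]. *)
pose e (i : 'I_d.+1) := (b ord_max * c i +
  (if unlift ord0 i is Some j then b (widen_ord (leqnSn d) j) else 0))%N.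
exists e.
have -> : a ^+ k.+1 - \sum_(i < d.+1) (e i)%:R * a ^+ i =
   a * (a ^+ k - \sum_(i < d.+1) (b i)%:R * a ^+ i) +
   (b ord_max)%:R * (a ^+ d.+1 - \sum_(i < d.+1) (c i)%:R * a ^+ i).
  under eq_bigr => i _ do rewrite /e natrD mulrDl.
  rewrite big_split/=.
  have -> : \sum_(i < d.+1) (b ord_max * c i)%:R * a ^+ i =
     (b ord_max)%:R * (\sum_(i < d.+1) (c i)%:R * a ^+ i).
    by rewrite mulr_sumr; apply: eq_bigr => i _; rewrite natrM mulrA.
  rewrite [X in _ - (_ + X)]big_ord_recl unlift_none mul0r add0r.
  rewrite [X in a * (_ - X)]big_ord_recr /=.
  have -> : \sum_(i < d) (match unlift ord0 (lift ord0 i) with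
      | Some j => b (widen_ord (leqnSn d) j) | None => 0%N end)%:R * a ^+ (bump 0 i) =
      a * \sum_(i < d) (b (widen_ord (leqnSn d) i))%:R * a ^+ i.
    rewrite mulr_sumr; apply: eq_bigr => i _; rewrite liftK /bump add1n exprS; ring.
  by rewrite !exprS; ring.
apply: pabs_addlt; rewrite pabsM.
  by rewrite (le_lt_trans _ hb)// ler_piMl ?pabs_ge0.
by rewrite (le_lt_trans _ hc)// ler_piMl ?pabs_ge0// pabs_nat_le1.
Qed.

(* The residues of the powers of a lie in the finite set of combinations of
   1, a, ..., a^(d-1) with coefficients below p, so two of them coincide. *)
Lemma residue_torsion a d (c : 'I_d -> nat) : pabs a = 1 ->
  pabs (a ^+ d - \sum_(i < d) (c i)%:R * a ^+ i) < 1 ->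
  exists n, (0 < n)%N /\ pabs (a ^+ n - 1) < 1.
Proof.
move=> a1 hc; have a1' : pabs a <= 1 by rewrite a1.
have /choice[t ht] : forall k, exists t : {ffun 'I_d -> 'I_p},
    pabs (a ^+ k - \sum_(i < d) (t i)%:R * a ^+ i) < 1.
  move=> k; have [b hb] := pow_residue_span a1' hc k.
  exists [ffun i => Ordinal (ltn_pmod (b i) p0)].
  apply: (residue_trans hb); rewrite -sumrB; apply: pabs_sumlt => // i _.
  rewrite ffunE /= -mulrBl -natrB ?leq_mod// pabsM pabsX a1 expr1n mulr1.
  by apply: (pabs_dvd p_prime hp); rewrite {1}(divn_eq (b i) p) addnK dvdn_mull.
pose T : finType := {ffun 'I_d -> 'I_p}.
have : ~ injective (fun k : 'I_(#|T|.+1) => t k).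
  by move=> /leq_card; rewrite card_ord ltnn.
move=> /injectiveP /injectivePn[k [l kl htkl]].
have aux (m n : nat) : (m < n)%N -> t m = t n -> exists n, (0 < n)%N /\ pabs (a ^+ n - 1) < 1.
  move=> mn tmn; exists (n - m)%N; split; first by rewrite subn_gt0.
  have -> : pabs (a ^+ (n - m) - 1) = pabs (a ^+ n - a ^+ m).
    have -> : a ^+ n - a ^+ m = a ^+ m * (a ^+ (n - m) - 1).
      by rewrite mulrBr mulr1 -exprD subnKC// ltnW.
    by rewrite pabsM pabsX a1 expr1n mul1r.
  by apply: (residue_trans (ht n)); rewrite -tmn pabsB.
move: kl; rewrite -val_eqE neq_ltn => /orP[kl|lk]; first exact: aux kl htkl.
exact: aux lk (esym htkl).
Qed.

(** With v = 1 + u, the inner binomials are divisible by p, so v^p - 1 agrees with u^p in the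
    residue field. *)
Lemma residue_frobenius_inj v : pabs v <= 1 -> pabs (v ^+ p - 1) < 1 -> pabs (v - 1) < 1.
Proof.
move=> v1 hv; pose u := v - 1.
have u1 : pabs u <= 1 by rewrite pabs_suble ?pabs1.
have h : pabs (u ^+ p) < 1.
  have hE : v ^+ p - 1 = \sum_(1 <= i < p.+1) u ^+ i *+ 'C(p, i).
    have -> : v = 1 + u by rewrite addrC subrK.
    rewrite exprDn big_ord_recl /= expr1n expr0 mulr1 bin0 addrC addKr.
    rewrite big_add1 big_mkord; apply: eq_bigr => i _.
    by rewrite expr1n mul1r.
  rewrite big_nat_recr //= binn in hE.
  have -> : u ^+ p = (v ^+ p - 1) - \sum_(1 <= i < p) u ^+ i *+ 'C(p, i).
    by rewrite hE addrAC subrr add0r.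
  apply: pabs_sublt => //; rewrite big_nat; apply: pabs_sumlt => // i hi.
  rewrite -mulr_natl pabsM (le_lt_trans _ (pabs_dvd p_prime hp (prime_dvd_bin p_prime hi)))//.
  by rewrite ler_piMr ?pabs_ge0// pabsX exprn_ile1 ?pabs_ge0.
rewrite ltNge; apply/negP => h1; move: h; rewrite ltNge pabsX => /negP[].
exact: exprn_ege1.
Qed.

Lemma root_of_unity_pabs z n : n.-primitive_root z -> pabs z = 1.
Proof.
move=> hz; have n0 := prim_order_gt0 hz.
by apply/eqP; rewrite -(pexpr_eq1 n0) ?pabs_ge0// -pabsX (prim_expr_order hz) pabs1.
Qed.

Hypothesis closedC : GRing.closed_field_axiom C.

(** The p-part of n is stripped off by [residue_frobenius_inj]. For the remaining m, u^m - 1 is the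
    product of the u - z over the m-th roots of unity, so some factor is small. *)
Lemma teich_ex_of_torsion u n : pabs u = 1 -> (0 < n)%N -> pabs (u ^+ n - 1) < 1 ->
  exists z, (exists n : nat, coprime n p /\ n.-primitive_root z) /\ pabs (u - z) < 1.
Proof.
move=> u1 n0; have [m cpm ->] := pfactor_coprime p_prime n0.
move=> hu; have {hu n0} hm : pabs (u ^+ m - 1) < 1.
  move: (logn p n) hu => k; elim: k => [|k IH]; first by rewrite expn0 muln1.
  rewrite expnSr mulnA exprM => hu; apply: IH; apply: residue_frobenius_inj => //.
  by rewrite pabsX u1 expr1n.
have m0 : (0 < m)%N.
  by rewrite lt0n; apply: contraTneq cpm => ->; rewrite /coprime gcdn0 gtn_eqF// prime_gt1.
have mon : ('X^m - 1 : {poly C}) \is monic by exact: monicXnsubC.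
have [s hs] := monic_splits closedC mon.
have hu : \prod_(z <- s) pabs (u - z) < 1.
  have -> : \prod_(z <- s) pabs (u - z) = pabs (u ^+ m - 1).
    have -> : u ^+ m - 1 = ('X^m - 1 : {poly C}).[u] by rewrite !hornerE.
    rewrite hs horner_prod; elim: s {hs} => [|z s IH]; first by rewrite !big_nil pabs1.
    by rewrite !big_cons IH !hornerE pabsM.
  exact: hm.
have [z zs hz] : exists2 z, z \in s & pabs (u - z) < 1.
  apply: contrapT => hno; move: hu; rewrite ltNge => /negP[]; rewrite big_seq.
  apply: (big_ind (fun r : R => 1 <= r)) => // [r r' h1 h2|z zs].
    by rewrite (le_trans h1)// ler_peMr// (le_trans ler01).
  by rewrite leNgt; apply/negP => hz; apply: hno; exists z.
have zm : z ^+ m = 1.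
  apply/eqP; rewrite -subr_eq0; apply/eqP.
  have -> : z ^+ m - 1 = ('X^m - 1 : {poly C}).[z] by rewrite !hornerE.
  by apply/rootP; rewrite hs root_prod_XsubC.
have [k hk km] := prim_order_exists m0 zm.
by exists z; split=> //; exists k; split=> //; rewrite (coprime_dvdl km)// coprime_sym.
Qed.

Hypothesis hdense : dense [set x : C | algebraic_over (@Qp R C) x].

Lemma teich_ex u : pabs u = 1 ->
  exists z, (exists n : nat, coprime n p /\ n.-primitive_root z) /\ pabs (u - z) < 1.
Proof.
move=> u1; have [a [alg ha]] := algebraic_approx hdense u ltr01.
have a1 : pabs a = 1.
  by rewrite -u1 -(pabs_addl (x := u) (y := - (u - a))) ?pabsN ?u1// opprB addrC subrK.
have [|d [c hc]] := algebraic_monic_residue p_prime hp alg; first by rewrite a1.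
have [n [n0 hn]] := residue_torsion a1 hc.
apply: (teich_ex_of_torsion u1 n0); apply: residue_trans hn.
by apply: le_lt_trans ha; apply: pabs_subX_le; rewrite ?u1 ?a1.
Qed.

Variable iota : {rmorphism algC -> C}.

(** All that is used of z, the image of the d-th root, is z^d = p, and this fixes its absolute
    value. *)
Lemma pabs_ppow r : pabs (ppow p iota r) = p%:R `^ (- ratr r).
Proof.
rewrite /ppow /ppow_alg; set d := `|denq r|%N; have d0 : (0 < d)%N by exact: absz_denq_gt0.
set z := iota (d.-root (p%:R : algC)).
have hz : z ^+ d = p%:R by rewrite /z -rmorphXn/= rootCK// rmorph_nat.
have -> : iota ((d.-root (p%:R : algC)) ^ numq r) = z ^ numq r.
  by case: (numq r) => n; rewrite /exprz ?fmorphV rmorphXn.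
have zE : pabs z = p%:R `^ (- d%:R^-1).
  apply/eqP; rewrite -(eqrXn2 d0) ?pabs_ge0 ?powR_ge0// -pabsX hz hp.
  rewrite -powR_mulrn ?powR_ge0// -powRrM mulNr mulVf ?pnatr_eq0 -?lt0n//.
  by rewrite powR_inv1.
rewrite pabsXz zE -powR_intmul ?powR_ge0// -powRrM; congr (_ `^ _).
have -> : ratr r = (numq r)%:~R / d%:R :> R.
  rewrite /ratr; congr (_ / _); rewrite -{1}[denq r]gez0_abs//; exact/ltW/denq_gt0.
by rewrite mulNr mulrC.
Qed.

Lemma ppowN r : ppow p iota (- r) = (ppow p iota r)^-1.
Proof. by rewrite /ppow /ppow_alg numqN denqN -invr_expz fmorphV. Qed.

Lemma pabs_ppow_vp x : x != 0 -> pabs (ppow p iota (vp p x)) = pabs x.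
Proof.
move=> x0; rewrite pabs_ppow; apply/esym.
exact: (xgetPex 0 (pabs_value_group p_prime hp hdense x0)).
Qed.

Lemma teich_spec x : x != 0 -> pabs (teich p iota x) = 1 /\
  pabs (x / ppow p iota (vp p x) - teich p iota x) < 1.
Proof.
move=> x0; have u1 : pabs (x / ppow p iota (vp p x)) = 1.
  by rewrite pabs_div pabs_ppow_vp// divff// pabs_eq0.
have [[n [_ hn]] h] := xgetPex 1 (teich_ex u1).
by split=> //; exact: root_of_unity_pabs hn.
Qed.

Lemma angle_sub1 x : x != 0 -> pabs (angle p iota x - 1) < 1.
Proof.
move=> x0; have [t1 ht] := teich_spec x0.
have t0 : teich p iota x != 0 by rewrite -pabs_gt0 t1.
have -> : angle p iota x - 1 = (x / ppow p iota (vp p x) - teich p iota x) / teich p iota x.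
  by rewrite mulrBl divff// /angle ppowN [_^-1 * x]mulrC.
by rewrite pabs_div t1 divr1.
Qed.

(** [vp] only sees |x|, and the candidates for [teich] only see x / p^v up to an error below 1.
    These sets agree for x and x + d, so [xget] makes the same choice. *)
Lemma angleD x d : x != 0 -> pabs d < pabs x ->
  angle p iota (x + d) = angle p iota x * (1 + d / x).
Proof.
move=> x0 hd; have vE : vp p (x + d) = vp p x by rewrite /vp pabs_addl.
have tE : teich p iota (x + d) = teich p iota x.
  rewrite /teich vE; congr xget; apply/seteqP.
  have P0 := pabs_ppow_vp x0; set P := ppow p iota (vp p x) in P0 *.
  have dP : pabs (d / P) < 1 by rewrite pabs_div P0 ltr_pdivrMr ?pabs_gt0// mul1r.
  split=> z /= [hz h]; split=> //.
    have -> : x / P - z = ((x + d) / P - z) - d / P by ring.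
    exact: pabs_sublt.
  have -> : (x + d) / P - z = (x / P - z) + d / P by ring.
  exact: pabs_addlt.
by rewrite /angle vE tE; field; rewrite x0 /= -pabs_gt0 (teich_spec x0).1.
Qed.

End Teichmuller.

(** * The expansion *)

Lemma EulerE0 (K : fieldType) N (w : N.-tuple K) : (2 : K) != 0 -> EulerE 0 0 w = 1.
Proof.
move=> two; rewrite /EulerE psexp0 psscale1mul fact0 mul1r /psscale.
set f := \big[_/_]_(j < N) _.
have f0 : f 0%N = 2 ^+ N.
  rewrite /f bigpsmul0; under eq_bigr => j _ do rewrite /psadd /psexp /ps1 expr0 fact0 divr1.
  by rewrite prodr_const card_ord.
have f0' : f 0%N != 0 by rewrite f0 expf_neq0.
have := psmulVf f0' => /(congr1 (fun g => g 0%N)).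
by rewrite /psmul big_ord1 subnn /ps1 /= f0 mulrC.
Qed.

(* For c = (s - 1)^-1 and b = pbinom (- s - 1), the difference quotient at 0 of
   s |-> (s - 1)^-1 * pbinom (1 - s) n; for c = -1 and b n = (-1)^n, its limit. *)
Definition quot_coef (K : fieldType) (c : K) (b : nat -> K) (n : nat) : K :=
  match n with
  | 0 => c
  | 1 => 0
  | n'.+2 => b n' / (n'.+2%:R * n'.+1%:R)
  end.

Section LogGamma.
Variables (R : realType) (p : nat) (C : valuedField R).
Variables (iota : {rmorphism algC -> C}) (N : nat) (w : N.-tuple C) (x : C).
Hypotheses (hC : is_Cp p C) (p_prime : prime p) (p_odd : odd p).
Hypotheses (x_neq0 : x != 0).
Hypothesis x_large : \big[Num.max/0]_(i < N) pabs (tnth w i) < pabs x.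

Let hp : pabs (p%:R : C) = p%:R^-1. Proof. by case: hC. Qed.
Let closedC : GRing.closed_field_axiom C. Proof. by case: hC. Qed.
Let complete : forall F : set_system C, ProperFilter F -> cauchy F -> cvg F.
Proof. by case: hC. Qed.
Let hdense : dense [set x : C | algebraic_over (@Qp R C) x].
Proof. by case: hC. Qed.

Let delta (t : N.-tuple C) := \sum_(i < N) tnth w i * tnth t i.
Let y := angle p iota x.
(** [rho0] bounds v and serves the final series; [rho] also bounds y - 1 and serves the series in Y
    - 1. *)
Let rho0 := (\big[Num.max/0]_(i < N) pabs (tnth w i)) / pabs x.
Let rho := Num.max (pabs (y - 1)) rho0.

Let x1 : 0 < pabs x. Proof. by rewrite pabs_gt0. Qed.
Let y1 : pabs (y - 1) < 1. Proof. exact: angle_sub1. Qed.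

Let py : pabs y = 1.
Proof. by rewrite -(subrK 1 y) addrC pabs_addl pabs1. Qed.

Let y0 : y != 0. Proof. by rewrite -pabs_gt0 py. Qed.

Let rho0_ge0 : 0 <= rho0.
Proof.
rewrite divr_ge0 ?pabs_ge0//; apply: (big_ind (fun r : R => 0 <= r)) => [//|r s hr hs|i _].
  by rewrite le_max hr.
exact: pabs_ge0.
Qed.

Let rho_ge0 : 0 <= rho. Proof. by rewrite le_max rho0_ge0 orbT. Qed.

Let rho0_lt1 : rho0 < 1. Proof. by rewrite ltr_pdivrMr// mul1r. Qed.

Let rho_lt1 : rho < 1. Proof. by rewrite gt_max y1. Qed.

Let v t := delta t / x.
(** This is Y(t) - 1, split into two small summands so that its powers expand into powers of v. *)
Let l t := (y - 1) + y * v t.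

Let v_le t : natural_tuple t -> pabs (v t) <= rho0.
Proof.
move=> ht; rewrite pabs_div ler_pM2r ?invr_gt0//.
apply: pabs_sumle => [|i _].
  by move: rho0_ge0; rewrite /rho0 pmulr_lge0 ?invr_gt0.
rewrite pabsM; apply: le_trans (le_bigmax _ _ i).
by rewrite ler_piMr ?pabs_ge0// natural_le1.
Qed.

Let l_le t : natural_tuple t -> pabs (l t) <= rho.
Proof.
move=> ht; apply: pabs_addle; first by rewrite le_max lexx.
by rewrite pabsM py mul1r le_max v_le ?orbT.
Qed.

Let v_lt1 t : natural_tuple t -> pabs (v t) < 1.
Proof. by move=> ht; apply: le_lt_trans (v_le ht) _. Qed.

Let l_lt1 t : natural_tuple t -> pabs (l t) < 1.
Proof. by move=> ht; apply: le_lt_trans (l_le ht) _. Qed.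

Let lE t : 1 + l t = y * (1 + v t). Proof. by rewrite /l; ring. Qed.

Let angleE t : natural_tuple t -> angle p iota (x + delta t) = 1 + l t.
Proof.
move=> ht; rewrite lE (angleD p_prime hp closedC)//.
by have := v_lt1 ht; rewrite pabs_div ltr_pdivrMr// mul1r.
Qed.

Let two_neq0 : (2 : C) != 0. Proof. exact: (natr_neq0 p_prime hp). Qed.

Let is_fint_v k : is_fint p (fun t => v t ^+ k) (EulerE k 0 w * x ^- k).
Proof.
rewrite mulrC; apply: eq_is_fint (is_fintZ (x ^- k) (is_fint_pow p_prime p_odd hp w k)) => t _.
by rewrite /v expr_div_n mulrC.
Qed.

Let is_fint1 : is_fint p (fun _ : N.-tuple C => 1) 1.
Proof.
have := is_fint_v 0; rewrite EulerE0// expr0 invr1 mulr1.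
by apply: eq_is_fint => t _; rewrite expr0.
Qed.

Let l_moment_ex n : exists c, is_fint p (fun t => l t ^+ n) c.
Proof.
exists (\sum_(i < n.+1) ('C(n, i)%:R * (y - 1) ^+ (n - i) * y ^+ i) * (EulerE i 0 w * x ^- i)).
have h := is_fint_sum (index_enum _) (fun i : 'I_n.+1 =>
  is_fintZ ('C(n, i)%:R * (y - 1) ^+ (n - i) * y ^+ i) (is_fint_v i)).
apply: eq_is_fint h => t _; rewrite /l exprDn; apply: eq_bigr => i _.
by rewrite -[RHS]mulr_natl (exprMn _ y) !mulrA.
Qed.

Let c n := fermionic_iter p (fun t => l t ^+ n).

Let is_fint_l n : is_fint p (fun t => l t ^+ n) (c n).
Proof. by have [k hk] := l_moment_ex n; rewrite /c (is_fintP hk). Qed.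

Let l_pow_le n t : natural_tuple t -> pabs (l t ^+ n) <= rho ^+ n.
Proof. by move=> ht; rewrite pabsX lerXn2r ?nnegrE ?pabs_ge0// l_le. Qed.

Let c_le n : pabs (c n) <= rho ^+ n.
Proof. by apply: is_fint_le (is_fint_l n) => t; exact: l_pow_le. Qed.

(** * The zeta function as a series and its derivative at zero *)

Let Zp0 : @Zp R C 0. Proof. exact: (@Zp_nat R C 0). Qed.

Let Zp1 : @Zp R C 1. Proof. exact: (@Zp_nat R C 1). Qed.

Let zetaE_sum s : @Zp R C s ->
  is_sum 0 (fun n => pbinom (1 - s) n * c n) (zetaE p iota s x w).
Proof.
move=> hs; have hs1 : @Zp R C (1 - s).
  exact: ZpD Zp1 (ZpN p_prime hp hs).
have hB := vanishing_geometric rho_ge0 rho_lt1.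
have b1 n := pbinom_le1 p_prime hp n hs1.
have [Z hZ] : exists Z, is_sum 0 (fun n => pbinom (1 - s) n * c n) Z.
  apply: (is_sum_ex complete hB) => n _.
  by rewrite pabsM (le_trans _ (c_le n))// ler_piMl ?pabs_ge0.
have fle n t : natural_tuple t -> pabs (pbinom (1 - s) n * l t ^+ n) <= rho ^+ n.
  by move=> ht; rewrite pabsM (le_trans _ (l_pow_le n ht))// ler_piMl ?pabs_ge0.
suff h : is_fint p (fun t : N.-tuple C => ppower (angle p iota (x + delta t)) (1 - s)) Z.
  by have -> : zetaE p iota s x w = Z by exact: is_fintP h.
apply: (is_fint_series complete hB (f := fun n t => pbinom (1 - s) n * l t ^+ n) _ _ _ hZ).
- by move=> n t _; exact: fle.
- move=> t ht; rewrite /ppower angleE// [1 + l t]addrC addrK.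
  have [k hk] := is_sum_ex complete (m := 0) hB (fun n _ => fle n t ht).
  by rewrite (is_sumP hk).
- by move=> n; exact: is_fintZ.
Qed.

(** At n = 0 the bound n^2 rho^n is zero while the coefficient has absolute value 1, hence the
    exceptional value. *)
Let Bq n : R := if n == 0%N then 1 else n%:R ^+ 2 * rho ^+ n.

Let Bq_vanishing : vanishing Bq.
Proof.
move=> e e0; have [M hM] := vanishing_sqr_geometric rho_ge0 rho_lt1 e0.
by exists M.+1 => -[//|n] Mn; apply: hM; exact: ltnW.
Qed.

Let quot_coef_le (d : C) (b : nat -> C) n (z : C) : pabs d <= 1 -> (forall n, pabs (b n) <= 1) ->
  pabs z <= rho ^+ n -> pabs (quot_coef d b n * z) <= Bq n.
Proof.
move=> d1 b1 hz; rewrite pabsM /Bq; case: n hz => [|[|n]] hz /=.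
- by rewrite expr0 in hz; rewrite mulr_ile1 ?pabs_ge0.
- by rewrite pabs0 mul0r mulr_ge0 ?exprn_ge0.
- rewrite ler_pM ?pabs_ge0// pabsM (le_trans (y := pabs ((n.+2%:R * n.+1%:R : C)^-1)))//.
    by rewrite ler_piMl ?pabs_ge0.
  rewrite -natrM (le_trans (pabs_natV_le p_prime hp _))// -natrX ler_nat -mulnn.
  by rewrite leq_mul2l ltnW.
Qed.

(** For n >= 2, splitting off two factors of the binomial gives (1 - s)(-s), which cancels both s -
    1 and s, and the value at s = 0 vanishes. For n = 1 the function is constantly -1. *)
Let quotE (s : C) n : s != 0 -> s - 1 != 0 ->
  ((s - 1)^-1 * pbinom (1 - s) n - (0 - 1)^-1 * pbinom (1 - 0) n) / (s - 0) =
  quot_coef (s - 1)^-1 (pbinom (- s - 1)) n.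
Proof.
move=> s0 s1; rewrite !subr0 sub0r invrN1.
case: n => [|[|n]] /=.
- by rewrite !pbinom0; field; rewrite s1 s0.
- by rewrite !pbinomS1 !pbinom0; field; rewrite s0 s1 oner_eq0.
- have e1 := natr_neq0 p_prime hp (ltn0Sn n); have e2 := natr_neq0 p_prime hp (ltn0Sn n.+1).
  rewrite !pbinomS1 subrr !mul0r mulr0 mul0r.
  have -> : 1 - s - 1 = - s by ring.
  move: e1 e2; move: (n.+1%:R : C) (n.+2%:R : C) => k1 k2 e1 e2.
  by field; rewrite e1 e2 s0 s1.
Qed.

Let log_quot n : C := quot_coef (-1) (fun n => (-1) ^+ n) n.

Let log_quot_le n (z : C) : pabs z <= rho ^+ n -> pabs (log_quot n * z) <= Bq n.
Proof.
apply: quot_coef_le => [|k]; first by rewrite pabsN pabs1.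
by rewrite pabsX pabsN pabs1 expr1n.
Qed.

(** The powers p^M accumulate at 0 within Z_p, which makes the limit defining the derivative
    unique. *)
Let Zp_punctured_proper : ProperFilter (within (@Zp R C) (0 : C)^').
Proof.
apply: Build_ProperFilter_ex => P /=; rewrite /within /=.
rewrite /dnbhs /within/= -nbhs_ballE => -[e /= e0 he].
have [M _ /(_ M (leqnn M)) /=] := tendsto_pX p_prime hp e0; rewrite subr0 => hM.
exists (p ^ M)%:R; apply: he; rewrite ?ballE /=.
- by rewrite sub0r pabsN.
- by rewrite (natr_neq0 p_prime hp)// expn_gt0 prime_gt0.
- exact: Zp_nat.
Qed.

(** For s in Z_p with |s| < 1 one has |s - 1| = 1 and |binom(-s - 1, n)| <= 1, so [Bq] dominates the
    difference quotients independently of s. *)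
Let deriv_zeta L : is_sum 0 (fun n => log_quot n * c n) L ->
  deriv_Zp (fun s => (s - 1)^-1 * zetaE p iota s x w) 0 = L.
Proof.
move=> hL; apply: (@tendsto_lim _ _ _ _ Zp_punctured_proper).
have near0 e : 0 < e -> \forall s \near within (@Zp R C) (0 : C)^',
    [/\ pabs s < e, s != 0 & @Zp R C s].
  move=> e0; rewrite /within /= /dnbhs /within /= -nbhs_ballE; exists e => //= s.
  by rewrite ballE /= sub0r pabsN.
have hN1 : pabs (-1 : C) <= 1 by rewrite pabsN pabs1.
have s1 (s : C) : pabs s < 1 -> pabs (s - 1) = 1.
  by move=> hs; rewrite addrC pabs_addl pabsN pabs1.
apply: (@tendsto_is_sum R C C (within (@Zp R C) (0 : C)^') _ 0
  (fun s n => quot_coef (s - 1)^-1 (pbinom (- s - 1)) n * c n)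
  (fun n => log_quot n * c n) Bq _ L Bq_vanishing _ _ _ _ hL).
- apply: filterS (near0 1 ltr01) => s [hs _ zs] n _; apply: quot_coef_le => //.
    by rewrite pabsV s1// invr1.
  move=> k; apply: (pbinom_le1 p_prime hp); exact: ZpD (ZpN p_prime hp zs) (ZpN p_prime hp Zp1).
- by move=> n _; exact: log_quot_le.
- move=> n _; apply: tendstoM (tendsto_cst _); rewrite /log_quot.
  case: n => [|[|n]] /=; last 2 first.
  + exact: tendsto_cst.
  + apply: tendstoM (tendsto_cst _); rewrite -(pbinomN1 p_prime hp).
    apply: (tendsto_pbinom p_prime hp) => //.
      apply: filterS (near0 1 ltr01) => s [hs _ _].
      by rewrite pabs_suble ?pabs1// pabsN ltW.
    by move=> e /near0; apply: filterS => s [hs _ _]; rewrite opprK subrK pabsN.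
  + move=> e e0; have m0 : 0 < Num.min e 1 by rewrite lt_min e0 ltr01.
    apply: filterS (near0 _ m0) => s []; rewrite lt_min => /andP[hs hs1] _ _.
    have sn : s - 1 != 0 by rewrite -pabs_gt0 s1.
    have -> : (s - 1)^-1 - -1 = s / (s - 1) by field.
    by rewrite pabs_div s1// divr1.
- apply: filterS (near0 1 ltr01) => s [hs sn0 zs].
  have sn : s - 1 != 0 by rewrite -pabs_gt0 s1.
  have h1 := is_sumZ (s - 1)^-1 (zetaE_sum zs).
  have h2 := is_sumZ (- (0 - 1)^-1) (zetaE_sum Zp0).
  rewrite -mulNr [X in is_sum _ _ X]mulrC.
  apply: eq_is_sum (is_sumZ (s - 0)^-1 (is_sumD h1 h2)) => n _.
  by rewrite -quotE//; ring.
Qed.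

(** The terms -1 - u of -(1 + u) account for the coefficient -1 at n = 0 and, against the +u
    compensating [is_sum_entropy], for 0 at n = 1. *)
Let is_sum_log_quot (u : C) : pabs u < 1 ->
  is_sum 0 (fun n => log_quot n * u ^+ n) ((1 + u) * (plog1 (1 + u) - 1)).
Proof.
move=> u1.
have -> : (1 + u) * (plog1 (1 + u) - 1) = log_quot 0 * u ^+ 0 + (log_quot 1 * u ^+ 1 +
    ((1 + u) * plog1 (1 + u) - u)) by rewrite /log_quot /=; ring.
apply: is_sum_recl; apply: is_sum_recl.
apply: eq_is_sum (is_sum_entropy p_prime hp complete u1) => -[//|[//|n]] _.
by rewrite /log_quot /= -(natr1 n.+1) addrK !exprS; ring.
Qed.

Lemma LogGamma_expansion :
  let term (j : nat) : C :=
    (-1) ^+ j / (j%:R * (j%:R - 1)) * EulerE j 0 w * x ^ (1 - j%:Z) in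
  exists2 T, is_sum 2 term T & LogGammaDE p iota x w =
    x * (plog p iota x - 1) + EulerE 1 0 w * plog p iota x + T.
Proof.
move=> term.
have [L hL] : exists L, is_sum 0 (fun n => log_quot n * c n) L.
  by apply: (is_sum_ex complete Bq_vanishing) => n _; exact: log_quot_le.
have fL : is_fint p (fun t => (1 + l t) * (plog1 (1 + l t) - 1)) L.
  apply: (is_fint_series complete Bq_vanishing (f := fun n t => log_quot n * l t ^+ n) _ _ _ hL).
  - by move=> n t _ ht; apply: log_quot_le; exact: l_pow_le.
  - by move=> t ht; apply: is_sum_log_quot; exact: l_lt1.
  - by move=> n; exact: is_fintZ.
have hB := vanishing_sqr_geometric rho0_ge0 rho0_lt1.
pose a (j : nat) : C := (-1) ^+ j / (j%:R * (j%:R - 1)).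
have a_le j (z : C) : (2 <= j)%N -> pabs z <= rho0 ^+ j -> pabs (a j * z) <= j%:R ^+ 2 * rho0 ^+ j.
  case: j => [//|[//|j]] _ hz; rewrite pabsM ler_pM ?pabs_ge0// /a.
  rewrite -[j.+2%:R - 1]/(j.+2%:R - 1%:R) -natrB// subn1 /=.
  rewrite mulrC pabsMsign -natrM (le_trans (pabs_natV_le p_prime hp _))//.
  by rewrite -natrX ler_nat -mulnn leq_mul2l ltnW.
have v_pow_le t j : natural_tuple t -> pabs (v t ^+ j) <= rho0 ^+ j.
  by move=> ht; rewrite pabsX lerXn2r ?nnegrE ?pabs_ge0// v_le.
(* This sum lacks the factor x contributed by the prefactor x / y, whence the witness [x * T]
   below. *)
have [T hT] : exists T, is_sum 2 (fun j => a j * (EulerE j 0 w * x ^- j)) T.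
  apply: (is_sum_ex complete hB) => j j2; apply: a_le => //.
  by apply: is_fint_le (is_fint_v j) => t; exact: v_pow_le.
have fT : is_fint p (fun t => (1 + v t) * plog1 (1 + v t) - v t) T.
  apply: (is_fint_series complete hB (f := fun j t => a j * v t ^+ j) _ _ _ hT).
  - by move=> j t j2 ht; apply: a_le => //; exact: v_pow_le.
  - by move=> t ht; apply: (is_sum_entropy p_prime hp complete); exact: v_lt1.
  - by move=> j; exact: is_fintZ.
exists (x * T).
  apply: eq_is_sum (is_sumZ x hT) => j _.
  by rewrite /term /a expfzDr// expr1z -exprnN; ring.
rewrite /LogGammaDE (deriv_zeta hL).
have e1 := is_fint_v 1; rewrite expr1 in e1.
(* The summand v is added and subtracted so that what remains, (1 + v) log(1 + v) - v, is the
   integrand of [fT]. *)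
have fL' := is_fintZ y (is_fintD (is_fintD
  (is_fintZ (plog1 y - 1) (is_fintD is_fint1 e1)) e1) fT).
have -> : L = y * ((plog1 y - 1) * (1 + EulerE 1 0 w / x) + EulerE 1 0 w / x + T).
  rewrite -(is_fintP fL); apply: is_fintP; apply: eq_is_fint fL' => t ht.
  have -> : plog1 (1 + l t) = plog1 y + plog1 (1 + v t).
    rewrite lE -[in LHS](subrK 1 y) [in LHS](addrC (y - 1)).
    by rewrite (plog1M p_prime hp complete)// ?v_lt1// addrCA subrr addr0.
  by rewrite lE expr1; ring.
rewrite /plog -/y; field.
by rewrite x_neq0 y0.
Qed.

End LogGamma.

Theorem theorem3p10 (R : realType) (p : nat) (C : valuedField R)
    (iota : {rmorphism algC -> C}) (N : nat) (w : N.-tuple C) (x : C)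
    (hC : is_Cp p C) (p_prime : prime p) (p_odd : odd p) (N_gt0 : (0 < N)%N)
    (w_neq0 : forall i, tnth w i != 0) (x_neq0 : x != 0)
    (x_large : \big[Num.max/0]_(i < N) pabs (tnth w i) < pabs x) :
  let term (j : nat) : C :=
    (-1) ^+ j / (j%:R * (j%:R - 1)) * EulerE j 0 w * x ^ (1 - j%:Z) in
  cvg ((fun n => \sum_(2 <= j < n) term j) @ \oo) /\
  LogGammaDE p iota x w =
    x * (plog p iota x - 1) + EulerE 1 0 w * plog p iota x
    + \big[+%R/0]_(2 <= j <oo) term j.
Proof.
have [T hT ->] := LogGamma_expansion iota hC p_prime p_odd x_neq0 x_large.
by split; [exact: is_sum_cvg hT|rewrite (is_sumP hT)].
Qed.
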